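(* Let $R$ be a commutative ring and let $V\in \mathrm{SpUm}_{2n,2m}(R)$, where $m>n\geq 2$ or $m=n\geq 3$. Let $\delta\in \mathrm{Sp}_{2n}(R)$ be symplectic homotopic to the identity, and let $\delta(T)\in \mathrm{Sp}_{2n}(R[T])$ be a homotopy of $\delta$. Then there exists $\sigma(T)\in \mathrm{Sp}_{2m}(R[T],(T))$ such that $$\delta(T)V=V\sigma(T)\quad\text{and}\quad \sigma(T)^{-1}(\delta(T)\perp I_{2m-2n})\in \mathrm{ESp}_{2m}(R[T],(T)).$$ Moreover, if $\sigma:=\sigma(1)$, then $\delta V=V\sigma$ and $\sigma^{-1}(\delta\perp I_{2m-2n})\in \mathrm{ESp}_{2m}(R)$.
   Context: All rings are commutative with $1\neq 0$. Let $\psi_1=\begin{bmatrix}0&1\\-1&0\end{bmatrix}$ and $\psi_n=\psi_{n-1}\perp\psi_1$ for $n>1$, where $\alpha\perp\beta$ denotes the block diagonal matrix with blocks $\alpha,\beta$. $\mathrm{Sp}_{2m}(R)=\{\alpha\in \mathrm{GL}_{2m}(R)\mid \alpha^t\psi_m\alpha=\psi_m\}$. Let $\sigma_0$ be the permutation of the natural numbers with $\sigma_0(2i)=2i-1$, $\sigma_0(2i-1)=2i$. For $1\leq i\neq j\leq 2m$ and $z\in R$, put $se_{ij}(z)=I_{2m}+zE_{ij}$ if $i=\sigma_0(j)$, and $se_{ij}(z)=I_{2m}+zE_{ij}-(-1)^{i+j}zE_{\sigma_0(j)\sigma_0(i)}$ if $i\neq\sigma_0(j)$, where $E_{ij}$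 is the matrix unit. $\mathrm{ESp}_{2m}(R)$ is the subgroup of $\mathrm{Sp}_{2m}(R)$ generated by all the $se_{ij}(z)$. $\mathrm{Um}_{2n,2m}(R)$ is the set of $2n\times 2m$ matrices over $R$ having a right inverse, and $\mathrm{SpUm}_{2n,2m}(R)=\{V\in \mathrm{Um}_{2n,2m}(R)\mid V\psi_mV^t=\psi_n\}$. A matrix $\delta\in \mathrm{Sp}_{2n}(R)$ is symplectic homotopic to the identity if there is $\delta(T)\in \mathrm{Sp}_{2n}(R[T])$ with $\delta(0)=I_{2n}$ and $\delta(1)=\delta$; such a $\delta(T)$ is called a homotopy of $\delta$. $\mathrm{Sp}_{2m}(R[T],(T))$ is the group of $\sigma(T)\in \mathrm{Sp}_{2m}(R[T])$ with $\sigma(0)=I_{2m}$. $\mathrm{ESp}_{2m}(R[T],(T))$ is the relative elementary symplectic group, i.e. the normal closure in $\mathrm{ESp}_{2m}(R[T])$ of the $se_{ij}(f)$ with $f\in(T)$; equivalently the group of elements of $\mathrm{ESp}_{2m}(R[T])$ that become $I_{2m}$ at $T=0$. *)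

(* Defs.v *)
From HB Require Import structures.
From mathcomp Require Import all_boot all_order all_algebra.

Set Implicit Arguments.
Unset Strict Implicit.
Unset Printing Implicit Defensive.

Import GRing.Theory.
Local Open Scope ring_scope.

(* Mathematical Components library.  Matrices of even size 2n are indexed by
   'I_(n.*2); rows and columns are therefore numbered from 0, not from 1. *)

Definition perp (R : comNzRingType) (p q : nat) (A : 'M[R]_p) (B : 'M[R]_q) :
  'M[R]_(p + q) := block_mx A 0 0 B.

Definition psi1 (R : comNzRingType) : 'M[R]_2 :=
  delta_mx 0 1 - delta_mx 1 0.

(* The recursion starts from the empty matrix instead of psi_1; the cast only
   identifies n.*2 + 2 with n.+1.*2. *)
Fixpoint psi (R : comNzRingType) (n : nat) : 'M[R]_(n.*2) :=
  match n with
  | 0 => 0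
  | k.+1 => castmx (addn2 k.*2, addn2 k.*2) (perp (psi R k) (psi1 R))
  end.

(* For rings that are not unit rings in the library (such as {poly R}) invmx is
   not available, so two-sided inverses are handled relationally. *)
Definition mx_inverse (R : comNzRingType) (p : nat) (A B : 'M[R]_p) : Prop :=
  A *m B = 1%:M /\ B *m A = 1%:M.

Definition GL (R : comNzRingType) (p : nat) (A : 'M[R]_p) : Prop :=
  exists B, mx_inverse A B.

Definition Sp (R : comNzRingType) (m : nat) (A : 'M[R]_(m.*2)) : Prop :=
  GL A /\ A^T *m psi R m *m A = psi R m.

(* The permutation 2i <-> 2i-1 of {1, 2, ...}, shifted to numbering from 0:
   it exchanges 2i and 2i+1. *)
Definition sigma0_nat (k : nat) : nat := if odd k then k.-1 else k.+1.

Fact sigma0_subproof (m : nat) (i : 'I_(m.*2)) : (sigma0_nat i < m.*2)%N.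
Proof.
rewrite /sigma0_nat; case: ifP => oi; first exact: leq_ltn_trans (leq_pred i) _.
by rewrite ltn_neqAle ltn_ord andbT; apply/eqP => /(congr1 odd) /=; rewrite oi odd_double.
Qed.

Definition sigma0 (m : nat) (i : 'I_(m.*2)) : 'I_(m.*2) :=
  Ordinal (sigma0_subproof i).

(* The sign (-1)^(i+j) does not change when both indices are shifted by 1. *)
Definition se (R : comNzRingType) (m : nat) (i j : 'I_(m.*2)) (z : R) :
  'M[R]_(m.*2) :=
  if i == sigma0 j then 1%:M + z *: delta_mx i j
  else 1%:M + z *: delta_mx i j
       - ((-1) ^+ (i + j)%N * z) *: delta_mx (sigma0 j) (sigma0 i).

(* The subgroup of GL_p(R) generated by a set S of invertible matrices. *)
Inductive generated (R : comNzRingType) (p : nat) (S : 'M[R]_p -> Prop) :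
  'M[R]_p -> Prop :=
| gen_in A : S A -> generated S A
| gen_one : generated S 1%:M
| gen_mul A B : generated S A -> generated S B -> generated S (A *m B)
| gen_inv A B : generated S A -> mx_inverse A B -> generated S B.

Definition ESp (R : comNzRingType) (m : nat) : 'M[R]_(m.*2) -> Prop :=
  generated (fun A => exists (i j : 'I_(m.*2)) (z : R),
                        i != j /\ A = se i j z).

Definition Um (R : comNzRingType) (p q : nat) (V : 'M[R]_(p, q)) : Prop :=
  exists W : 'M[R]_(q, p), V *m W = 1%:M.

Definition SpUm (R : comNzRingType) (n m : nat) (V : 'M[R]_(n.*2, m.*2)) :
  Prop :=
  Um V /\ V *m psi R m *m V^T = psi R n.

Definition eval_mx (R : comNzRingType) (p q : nat) (a : R)
  (A : 'M[{poly R}]_(p, q)) : 'M[R]_(p, q) := map_mx (horner_eval a) A.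

Definition const_poly_mx (R : comNzRingType) (p q : nat) (A : 'M[R]_(p, q)) :
  'M[{poly R}]_(p, q) := map_mx polyC A.

Definition homotopy (R : comNzRingType) (n : nat) (delta : 'M[R]_(n.*2))
  (deltaT : 'M[{poly R}]_(n.*2)) : Prop :=
  [/\ Sp deltaT, eval_mx 0 deltaT = 1%:M & eval_mx 1 deltaT = delta].

Definition symplectic_homotopic_id (R : comNzRingType) (n : nat)
  (delta : 'M[R]_(n.*2)) : Prop := exists deltaT, homotopy delta deltaT.

Definition SpT (R : comNzRingType) (m : nat) (A : 'M[{poly R}]_(m.*2)) : Prop :=
  Sp A /\ eval_mx 0 A = 1%:M.

(* ESp_{2m}(R[T], (T)): the normal closure in ESp_{2m}(R[T]) of the se_ij(f)
   with f in the ideal (T), i.e. the subgroup generated by their conjugates. *)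
Definition ESpT (R : comNzRingType) (m : nat) : 'M[{poly R}]_(m.*2) -> Prop :=
  generated (fun A => exists (g h : 'M[{poly R}]_(m.*2)) (i j : 'I_(m.*2))
                             (f : {poly R}),
    [/\ ESp g, mx_inverse g h, i != j, (exists q, f = q * 'X)
      & A = g *m se i j f *m h]).

(* A perp I_{2m-2n} as a matrix of size 2m.  For n <= m, conform_mx transports
   along n.*2 + (m.*2 - n.*2) = m.*2; its first argument is a default value
   used only when n > m. *)
Definition stab (R : comNzRingType) (n m : nat) (A : 'M[R]_(n.*2)) :
  'M[R]_(m.*2) :=
  conform_mx 1%:M (perp A (1%:M : 'M[R]_(m.*2 - n.*2))).

(* Main.v *)
Require Import Defs.
From HB Require Import structures.
From mathcomp Require Import all_boot all_order all_algebra.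
From mathcomp Require Import generic_quotient ring_quotient boolp ring.
Set Implicit Arguments.
Unset Strict Implicit.
Unset Printing Implicit Defensive.
Import GRing.Theory.
Local Open Scope ring_scope.
Local Open Scope quotient_scope.

(** Put [W := - psi_m V^T psi_n], so that [V W = 1] and the columns of [W] are
    isometric, and let [sigma = 1 + W (delta - 1) V]: it acts as [delta] on the
    image of [W] and trivially on its orthogonal complement.  It remains to show
    that [g = sigma^-1 (delta perp I)] is elementary relative to [(T)].

    Everything rests on the transvections [1 + z v v^T psi].  For [m >= 2] all of
    them are elementary, without any unimodularity of [v]: [v] is the orthogonal
    sum of its first block and the rest, and a vector with a missing block is
    handled by conjugating a root element.  Hence the relative transvection groups
    are contained in the relative elementary groups, while being visibly normal in
    [Sp].  Moreover a denominator [s^k] in [v] is absorbed by a factor [s^(2k)] of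
    [z], which makes the dilation principle for [R -> R_s] immediate.

    Quillen's argument then applies: the [s] in [R] such that
    [g(x + s y) g(x)^-1] is a product of transvections relative to [y], over every
    [R]-algebra, form an ideal.  If over [R_s] some product [E] of transvections
    carries [W] to the first [2n] basis vectors, then [g] is a commutator with
    [E], so a power of [s] lies in the ideal.  Localizing successively at the
    entries of unimodular columns reaches this situation, and comaximality of these
    entries shows that [1] is in the ideal. *)

(** * The symplectic form and adjoints *)

Lemma sigma0K m : involutive (@sigma0 m).
Proof.
case=> [[|k] hk]; apply: val_inj; rewrite //= /sigma0_nat /=.
by case ok: (odd k) => /=; rewrite ok /=.
Qed.

Lemma sigma0_odd m (i : 'I_(m.*2)) : odd (sigma0 i) = ~~ odd i.
Proof.
by case: i => [[|k] hk]; rewrite //= /sigma0_nat /=; case ok: (odd k); rewrite /= ok.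
Qed.

Lemma sigma0_neq m (i : 'I_(m.*2)) : sigma0 i != i.
Proof.
by apply/eqP => /(congr1 (fun k : 'I__ => odd k)); rewrite sigma0_odd; case: odd.
Qed.

Lemma sigma0_half m (i : 'I_(m.*2)) : (sigma0 i)./2 = i./2.
Proof.
rewrite /= /sigma0_nat -(odd_double_half i).
by case: (odd i); rewrite /= ?odd_double ?add0n ?add1n /= ?uphalf_double doubleK.
Qed.

(** Induction on the block recursion: the four cases say whether row and column lie in the old part
    or in the last block. Later entrywise computations with [psi] go through this closed form. *)
Lemma psiE (R : comNzRingType) n (i j : 'I_(n.*2)) :
  psi R n i j = (-1) ^+ i *+ (j == sigma0 i).
Proof.
elim: n => [|n IHn] in i j *; first by case: i.
rewrite /= castmxE /perp.
have eqE k (p : 'I_(n.+1.*2)) :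
    cast_ord (esym (addn2 n.*2)) p = k -> (p : nat) = (k : nat) by move=> <-.
rewrite -[j == _]/((j : nat) == (sigma0 i : nat)) /= /sigma0_nat.
case: (splitP (cast_ord (esym (addn2 n.*2)) i)) => [i' Ei|i' Ei];
case: (splitP (cast_ord (esym (addn2 n.*2)) j)) => [j' Ej|j' Ej].
- have -> : cast_ord (esym (addn2 n.*2)) i = lshift 2 i' by apply: val_inj.
  have -> : cast_ord (esym (addn2 n.*2)) j = lshift 2 j' by apply: val_inj.
  by move: Ei Ej => /= -> ->; rewrite block_mxEul IHn.
- have -> : cast_ord (esym (addn2 n.*2)) i = lshift 2 i' by apply: val_inj.
  have -> : cast_ord (esym (addn2 n.*2)) j = rshift n.*2 j' by apply: val_inj.
  move: Ei Ej => /= -> ->; rewrite block_mxEur mxE.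
  case: eqP => // E; have := ltn_ord (sigma0 i'); rewrite /= /sigma0_nat -E.
  by rewrite -ltn_subRL subnn.
- have -> : cast_ord (esym (addn2 n.*2)) i = rshift n.*2 i' by apply: val_inj.
  have -> : cast_ord (esym (addn2 n.*2)) j = lshift 2 j' by apply: val_inj.
  move: Ei Ej => /= -> ->; rewrite block_mxEdl mxE.
  case: eqP => // E; have := ltn_ord j'; rewrite E oddD odd_double /=.
  by case: i' {E} => [] [|[|]] //= _; rewrite ?addn0 ?addn1 /= ?ltnn // ltnNge leqnSn.
- have -> : cast_ord (esym (addn2 n.*2)) i = rshift n.*2 i' by apply: val_inj.
  have -> : cast_ord (esym (addn2 n.*2)) j = rshift n.*2 j' by apply: val_inj.
  move: Ei Ej => /= -> ->; rewrite block_mxEdr oddD odd_double /=.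
  rewrite exprD -signr_odd odd_double mul1r !mxE.
  case: i' => [] [|[|]] // ? /=; case: j' => [] [|[|]] // ? /=;
  by rewrite ?addn0 ?addn1 /= ?eqxx ?(ltn_eqF (ltnSn _)) ?(gtn_eqF (ltnSn _))
    ?subr0 ?sub0r ?expr0 ?expr1 ?mulr0n ?mulr1n.
Qed.

Lemma tr_psi (R : comNzRingType) n : (psi R n)^T = - psi R n.
Proof.
apply/matrixP => i j; rewrite !mxE !psiE.
rewrite eq_sym -(inj_eq (can_inj (@sigma0K n))) sigma0K.
case: eqP => [->|]; last by rewrite oppr0.
by rewrite -signr_odd -[in RHS]signr_odd sigma0_odd; case: odd; rewrite /= ?opprK.
Qed.

Lemma psi_sqr (R : comNzRingType) n : psi R n *m psi R n = - 1%:M.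
Proof.
apply/matrixP => i j; rewrite !mxE (bigD1 (sigma0 i)) //= big1 ?addr0 => [|k].
  rewrite !psiE eqxx mulr1n sigma0K mulrnAr eq_sym -exprD -signr_odd oddD.
  by rewrite sigma0_odd addbN addbb expr1 mulNrn.
by rewrite psiE => /negPf->; rewrite mul0r.
Qed.

Lemma map_psi (A B : comNzRingType) (f : {rmorphism A -> B}) n :
  map_mx f (psi A n) = psi B n.
Proof. by apply/matrixP=> i j; rewrite mxE !psiE rmorphMn rmorphXn rmorphN1. Qed.

(* The adjoint with respect to the forms [psi] (not the adjugate): it is the inverse
   on [Sp], and [V *m adj V = 1] expresses [V psi V^T = psi]. *)
Definition adj (R : comNzRingType) m n (U : 'M[R]_(m.*2, n.*2)) :
  'M[R]_(n.*2, m.*2) := - (psi R n *m U^T *m psi R m).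

Lemma adjM (R : comNzRingType) m n p (X : 'M[R]_(m.*2, n.*2))
  (Y : 'M[R]_(n.*2, p.*2)) : adj (X *m Y) = adj Y *m adj X.
Proof.
rewrite /adj mulNmx mulmxN opprK trmx_mul !mulmxA -[_ *m psi R n *m psi R n]mulmxA.
by rewrite psi_sqr mulmxN mulmx1 !mulNmx.
Qed.

Lemma adjK (R : comNzRingType) m n (U : 'M[R]_(m.*2, n.*2)) : adj (adj U) = U.
Proof.
rewrite /adj linearN /= !trmx_mul trmxK !tr_psi mulmxN !mulmxA.
by rewrite !(mulmxN, mulNmx) psi_sqr !mulNmx mul1mx -mulmxA psi_sqr mulmxN mulmx1 !opprK.
Qed.

Lemma adj_mx1 (R : comNzRingType) m : adj (1%:M : 'M[R]_(m.*2)) = 1%:M.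
Proof. by rewrite /adj trmx1 mulmx1 psi_sqr opprK. Qed.

Lemma map_adj (A B : comNzRingType) (f : {rmorphism A -> B}) m n
  (U : 'M[A]_(m.*2, n.*2)) : map_mx f (adj U) = adj (map_mx f U).
Proof. by rewrite /adj map_mxN !map_mxM map_trmx !map_psi. Qed.

(** A one-sided inverse of a square matrix over a commutative ring is two-sided, and [psi_sqr] lets
    [psi] be cancelled from the defining equation. *)
Lemma SpP (R : comNzRingType) m (X : 'M[R]_(m.*2)) :
  Sp X <-> adj X *m X = 1%:M.
Proof.
rewrite /Sp; set Z := _ *m X.
have E : adj X *m X = - (psi R m *m Z) by rewrite /adj mulNmx !mulmxA.
split=> [[_ H]|H]; first by rewrite E H psi_sqr opprK.
split; first by exists (adj X); split=> //; apply: mulmx1C.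
rewrite -[Z]mul1mx -[1%:M]opprK -psi_sqr mulNmx -mulmxA.
by rewrite -[psi R m *m Z]opprK -E H mulmxN opprK mulmx1.
Qed.

Lemma SpVl (R : comNzRingType) m (X : 'M[R]_(m.*2)) : Sp X -> adj X *m X = 1%:M.
Proof. by move/SpP. Qed.

Lemma SpVr (R : comNzRingType) m (X : 'M[R]_(m.*2)) : Sp X -> X *m adj X = 1%:M.
Proof. by move/SpVl/mulmx1C. Qed.

(** Turns the relational inverses of [gen_inv] and [mx_inverse] into the formula [adj], which
    commutes with ring morphisms. *)
Lemma Sp_inv_adj (R : comNzRingType) m (X Y : 'M[R]_(m.*2)) :
  Sp X -> mx_inverse X Y -> Y = adj X.
Proof. by move=> hX [XY _]; rewrite -[LHS]mul1mx -(SpVl hX) -mulmxA XY mulmx1. Qed.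

Lemma Sp1 (R : comNzRingType) m : Sp (1%:M : 'M[R]_(m.*2)).
Proof. by apply/SpP; rewrite adj_mx1 mulmx1. Qed.

Lemma SpM (R : comNzRingType) m (X Y : 'M[R]_(m.*2)) : Sp X -> Sp Y -> Sp (X *m Y).
Proof.
move=> /SpP hX /SpP hY; apply/SpP.
by rewrite adjM mulmxA -[_ *m _ *m X]mulmxA hX mulmx1.
Qed.

Lemma Sp_adj (R : comNzRingType) m (X : 'M[R]_(m.*2)) : Sp X -> Sp (adj X).
Proof. by move=> hX; apply/SpP; rewrite adjK SpVr. Qed.

Lemma Sp_mx_inverse (R : comNzRingType) m (X : 'M[R]_(m.*2)) :
  Sp X -> mx_inverse X (adj X).
Proof. by move=> hX; split; [apply: SpVr | apply: SpVl]. Qed.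

Lemma map_Sp (A B : comNzRingType) (f : {rmorphism A -> B}) m (X : 'M[A]_(m.*2)) :
  Sp X -> Sp (map_mx f X).
Proof. by move=> /SpP hX; apply/SpP; rewrite -map_adj -map_mxM hX map_mx1. Qed.

Definition sform (R : comNzRingType) m (u v : 'cV[R]_(m.*2)) : R :=
  (u^T *m psi R m *m v) 0 0.

Lemma sform_mx (R : comNzRingType) m (u v : 'cV[R]_(m.*2)) :
  u^T *m psi R m *m v = (sform u v)%:M.
Proof. by apply/matrixP=> i j; rewrite !ord1 [RHS]mxE eqxx. Qed.

Lemma sformDl (R : comNzRingType) m (u v w : 'cV[R]_(m.*2)) :
  sform (u + v) w = sform u w + sform v w.
Proof. by rewrite /sform linearD /= !mulmxDl mxE. Qed.

Lemma sformDr (R : comNzRingType) m (u v w : 'cV[R]_(m.*2)) :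
  sform w (u + v) = sform w u + sform w v.
Proof. by rewrite /sform mulmxDr mxE. Qed.

Lemma sformZl (R : comNzRingType) m (u v : 'cV[R]_(m.*2)) a :
  sform (a *: u) v = a * sform u v.
Proof. by rewrite /sform linearZ /= -!scalemxAl mxE. Qed.

Lemma sformZr (R : comNzRingType) m (u v : 'cV[R]_(m.*2)) a :
  sform u (a *: v) = a * sform u v.
Proof. by rewrite /sform -scalemxAr mxE. Qed.

Lemma sformNl (R : comNzRingType) m (u v : 'cV[R]_(m.*2)) : sform (- u) v = - sform u v.
Proof. by rewrite -scaleN1r sformZl mulN1r. Qed.

Lemma sformC (R : comNzRingType) m (u v : 'cV[R]_(m.*2)) : sform u v = - sform v u.
Proof.
rewrite /sform -[in LHS](trmxK (_ *m v)) mxE !trmx_mul trmxK tr_psi mulNmx mulmxN.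
by rewrite mxE mulmxA.
Qed.

(** Skew-symmetry alone does not give this when 2 is zero or a zero divisor. Instead [psi] is N -
    N^T, and the 1 by 1 matrix v^T N v equals its transpose. *)
Lemma sformvv (R : comNzRingType) m (v : 'cV[R]_(m.*2)) : sform v v = 0.
Proof.
pose N : 'M[R]_(m.*2) := \matrix_(i, j) ((j == sigma0 i) && ~~ odd i)%:R.
have E : psi R m = N - N^T.
  apply/matrixP=> i j; rewrite !mxE psiE.
  rewrite -[in X in X && ~~ odd j](inj_eq (can_inj (@sigma0K m))) sigma0K eq_sym.
  rewrite [sigma0 i == j]eq_sym; case: eqP => [->|]; last by rewrite subr0.
  by rewrite sigma0_odd -signr_odd; case: odd; rewrite /= ?sub0r ?subr0.
rewrite /sform E mulmxBr mulmxBl mxE [X in _ + X]mxE.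
have -> : v^T *m N^T *m v = (v^T *m N *m v)^T by rewrite !trmx_mul trmxK mulmxA.
by rewrite [X in _ - X]mxE subrr.
Qed.

Lemma sform_Sp (R : comNzRingType) m (X : 'M[R]_(m.*2)) (u v : 'cV[R]_(m.*2)) :
  Sp X -> sform (X *m u) (X *m v) = sform u v.
Proof.
case=> _ H; rewrite /sform trmx_mul !mulmxA.
by rewrite -[_ *m X^T *m _]mulmxA -[_ *m _ *m X]mulmxA H.
Qed.

Definition bas (R : comNzRingType) m (i : 'I_(m.*2)) : 'cV[R]_(m.*2) := delta_mx i 0.
Arguments bas R {m} i.

Lemma sform_basl (R : comNzRingType) m (i : 'I_(m.*2)) (v : 'cV[R]_(m.*2)) :
  sform (bas R i) v = (-1) ^+ i * v (sigma0 i) 0.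
Proof.
rewrite /sform /bas trmx_delta -rowE mxE (bigD1 (sigma0 i)) //= big1 ?addr0 => [|k].
  by rewrite mxE psiE eqxx.
by rewrite mxE psiE => /negPf->; rewrite mul0r.
Qed.

Lemma bas_trpsi (R : comNzRingType) m (i : 'I_(m.*2)) :
  (bas R i)^T *m psi R m = (-1) ^+ i *: delta_mx 0 (sigma0 i).
Proof.
rewrite /bas trmx_delta -rowE; apply/rowP => j; rewrite !mxE psiE eqxx /=.
by case: eqP; rewrite ?mulr1 ?mulr0.
Qed.

(** * Transvections *)

Definition transv (R : comNzRingType) m (v : 'cV[R]_(m.*2)) (z : R) : 'M[R]_(m.*2) :=
  1%:M + z *: (v *m (v^T *m psi R m)).

(** The polarization of [transv]: for orthogonal [u] and [v] it is the cross term of the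
    transvection along [u + v]. *)
Definition transv2 (R : comNzRingType) m (u v : 'cV[R]_(m.*2)) (z : R) : 'M[R]_(m.*2) :=
  1%:M + z *: (u *m (v^T *m psi R m) + v *m (u^T *m psi R m)).

Lemma transv_mul (R : comNzRingType) m (v w : 'cV[R]_(m.*2)) z :
  transv v z *m w = w + (z * sform v w) *: v.
Proof.
rewrite /transv mulmxDl mul1mx -scalemxAl -[_ *m _ *m w]mulmxA sform_mx.
by rewrite mul_mx_scalar scalerA.
Qed.

Lemma transv2_mul (R : comNzRingType) m (u v w : 'cV[R]_(m.*2)) z :
  transv2 u v z *m w = w + (z * sform v w) *: u + (z * sform u w) *: v.
Proof.
rewrite /transv2 mulmxDl mul1mx -scalemxAl mulmxDl -(mulmxA u) -(mulmxA v) !sform_mx.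
by rewrite !mul_mx_scalar scalerDr !scalerA addrA.
Qed.

(** Tested on a vector, products of transvections become scalar arithmetic in values of [sform]. *)
Lemma mulmx_cV_inj (R : comNzRingType) p q (X Y : 'M[R]_(p, q)) :
  (forall w : 'cV[R]_q, X *m w = Y *m w) -> X = Y.
Proof.
move=> H; apply/matrixP => i j; have := H (delta_mx j 0).
by rewrite -!colE => /colP/(_ i); rewrite !mxE.
Qed.

Lemma transvD (R : comNzRingType) m (v : 'cV[R]_(m.*2)) a b :
  transv v a *m transv v b = transv v (a + b).
Proof.
apply: mulmx_cV_inj => w; rewrite -mulmxA !transv_mul sformDr sformZr sformvv mulr0 addr0.
by rewrite -addrA -scalerDl mulrDl [b * _ + _]addrC.
Qed.

Lemma transv0 (R : comNzRingType) m (v : 'cV[R]_(m.*2)) : transv v 0 = 1%:M.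
Proof. by rewrite /transv scale0r addr0. Qed.

Lemma transvZ (R : comNzRingType) m (v : 'cV[R]_(m.*2)) c z :
  transv (c *: v) z = transv v (c ^+ 2 * z).
Proof.
apply: mulmx_cV_inj => w; rewrite !transv_mul sformZl scalerA.
by congr (_ + _ *: _); ring.
Qed.

Lemma adj_transv (R : comNzRingType) m (v : 'cV[R]_(m.*2)) z :
  adj (transv v z) = transv v (- z).
Proof.
rewrite /adj /transv linearD /= linearZ /= trmx1 !trmx_mul trmxK tr_psi.
rewrite mulmxDr mulmx1 mulmxDl psi_sqr -scalemxAr -scalemxAl !mulNmx !mulmxN.
rewrite !mulNmx !mulmxA psi_sqr !mulNmx mul1mx opprK opprD opprK scaleNr.
by rewrite -!mulmxA.
Qed.

Lemma Sp_transv (R : comNzRingType) m (v : 'cV[R]_(m.*2)) z : Sp (transv v z).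
Proof. by apply/SpP; rewrite adj_transv transvD addNr transv0. Qed.

(** Invariance of the form moves the conjugation into the vector; this makes [TRel] normal in all of
    [Sp]. *)
Lemma transv_conj (R : comNzRingType) m (X : 'M[R]_(m.*2)) (v : 'cV[R]_(m.*2)) z :
  Sp X -> X *m transv v z *m adj X = transv (X *m v) z.
Proof.
move=> hX; apply: mulmx_cV_inj => w; rewrite -!mulmxA transv_mul.
rewrite transv_mul mulmxDr -scalemxAr !mulmxA SpVr // mul1mx.
congr (_ + (z * _) *: _); rewrite -[in LHS](sform_Sp _ _ hX) mulmxA SpVr //.
by rewrite mul1mx.
Qed.

Lemma transv2E (R : comNzRingType) m (u v : 'cV[R]_(m.*2)) z : sform u v = 0 ->
  transv2 u v z = transv (u + v) z *m transv u (- z) *m transv v (- z).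
Proof.
move=> uv; have vu : sform v u = 0 by rewrite sformC uv oppr0.
apply: mulmx_cV_inj => w; rewrite -!mulmxA !transv_mul transv2_mul.
rewrite !(sformDl, sformDr, sformZr) !sformvv uv vu !mulr0 !addr0.
by apply/matrixP => i j; rewrite !mxE; ring.
Qed.

Lemma transv2C (R : comNzRingType) m (u v : 'cV[R]_(m.*2)) z :
  transv2 u v z = transv2 v u z.
Proof. by rewrite /transv2 addrC addrC [u *m _ + _]addrC addrC. Qed.

(** A Heisenberg group law for fixed [p]: additivity in the second vector fails only by a
    transvection along [p], weighted by [sform q q']. *)
Lemma transv2_add (R : comNzRingType) m (p q q' : 'cV[R]_(m.*2)) z :
    sform p q = 0 -> sform p q' = 0 ->
  transv2 p (q + q') z =
  transv2 p q z *m transv2 p q' z *m transv p (- (z ^+ 2 * sform q q')).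
Proof.
move=> pq pq'; have qp : sform q p = 0 by rewrite sformC pq oppr0.
have q'p : sform q' p = 0 by rewrite sformC pq' oppr0.
apply: mulmx_cV_inj => w; rewrite -!mulmxA transv_mul !transv2_mul.
rewrite !(sformDl, sformDr, sformZr) !sformvv ?pq ?pq' ?qp ?q'p !mulr0 !addr0.
by apply/matrixP => i j; rewrite !mxE; ring.
Qed.

Lemma transv2Z (R : comNzRingType) m (p q : 'cV[R]_(m.*2)) c z :
  transv2 p (c *: q) z = transv2 p q (c * z).
Proof.
apply: mulmx_cV_inj => w; rewrite !transv2_mul sformZl !scalerA.
by congr (_ + _ *: _ + _ *: _); ring.
Qed.

Lemma transv2_self (R : comNzRingType) m (p : 'cV[R]_(m.*2)) z :
  transv2 p p z = transv p (2 * z).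
Proof.
apply: mulmx_cV_inj => w; rewrite transv2_mul transv_mul -addrA -scalerDl.
by congr (_ + _ *: _); ring.
Qed.

Lemma map_transv (A B : comNzRingType) (f : {rmorphism A -> B}) m (v : 'cV[A]_(m.*2)) z :
  map_mx f (transv v z) = transv (map_mx f v) (f z).
Proof.
by rewrite /transv map_mxD map_mx1 map_mxZ !map_mxM map_trmx map_psi.
Qed.

(** * Transvections are elementary *)

Lemma sform_bas (R : comNzRingType) m (i j : 'I_(m.*2)) :
  sform (bas R i) (bas R j) = (-1) ^+ i *+ (j == sigma0 i).
Proof. by rewrite sform_basl mxE eqxx andbT eq_sym mulr_natr. Qed.

Lemma cV_sum_bas (R : comNzRingType) m (v : 'cV[R]_(m.*2)) :
  v = \sum_i v i 0 *: bas R i.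
Proof.
apply/colP => i; rewrite summxE (bigD1 i) //= big1 => [|k /negPf ki].
  by rewrite !mxE !eqxx mulr1 addr0.
by rewrite !mxE eq_sym ki mulr0.
Qed.

Lemma se_long (R : comNzRingType) m (i : 'I_(m.*2)) (z : R) :
  se i (sigma0 i) z = transv (bas R i) ((-1) ^+ i * z).
Proof.
rewrite /se sigma0K eqxx /transv bas_trpsi -scalemxAr scalerA mulrAC -exprD.
by rewrite -signr_odd oddD addbb mul1r mul_delta_mx.
Qed.

Lemma se_short (R : comNzRingType) m (i j : 'I_(m.*2)) (z : R) :
  i != sigma0 j ->
  se i j z = transv2 (bas R i) (bas R (sigma0 j)) ((-1) ^+ (sigma0 j) * z).
Proof.
move=> ij; rewrite /se (negPf ij) /transv2 !bas_trpsi -!scalemxAr !mul_delta_mx.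
rewrite sigma0K scalerDr !scalerA -addrA; congr (_ + (_ *: _ + _)).
  by rewrite mulrAC -exprD -signr_odd oddD addbb mul1r.
(* [sigma0] flips parity, which accounts for the minus sign of the second term of [se]. *)
rewrite -scaleNr; congr (_ *: _); rewrite mulrAC -exprD -mulNr; congr (_ * _).
rewrite -signr_odd -[in RHS]signr_odd !oddD sigma0_odd addNb addbC.
by case: (_ (+) _); rewrite ?opprK.
Qed.

Lemma transv2_Sp (R : comNzRingType) m (u v : 'cV[R]_(m.*2)) z :
  sform u v = 0 -> Sp (transv2 u v z).
Proof. by move=> uv; rewrite transv2E //; do ![apply: SpM | apply: Sp_transv]. Qed.

Lemma sform_bas_short (R : comNzRingType) m (i j : 'I_(m.*2)) : i != j ->
  sform (bas R i) (bas R (sigma0 j)) = 0.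
Proof. by rewrite sform_bas (inj_eq (can_inj (@sigma0K m))) eq_sym => /negPf->. Qed.

Lemma Sp_se (R : comNzRingType) m (i j : 'I_(m.*2)) (z : R) :
  i != j -> Sp (se i j z).
Proof.
move=> ij; have [->|ij'] := eqVneq i (sigma0 j).
  by rewrite -[X in se _ X](sigma0K j) se_long; apply: Sp_transv.
by rewrite se_short //; apply: transv2_Sp; rewrite sform_bas_short.
Qed.

(** * Generated subgroups and the relative groups *)

Lemma generated_Sp (R : comNzRingType) m (S : 'M[R]_(m.*2) -> Prop) X :
  (forall Y, S Y -> Sp Y) -> generated S X -> Sp X.
Proof.
move=> hS; elim=> [A /hS //||A B _ hA _ hB|A B _ hA hAB]; first exact: Sp1.
  exact: SpM.
by rewrite (Sp_inv_adj hA hAB); apply: Sp_adj.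
Qed.

Lemma generated_sub (R : comNzRingType) p (S S' : 'M[R]_p -> Prop) X :
  (forall Y, S Y -> generated S' Y) -> generated S X -> generated S' X.
Proof.
move=> hS; elim=> [A /hS //||A B _ hA _ hB|A B _ hA hAB]; first exact: gen_one.
  exact: gen_mul.
exact: gen_inv hA hAB.
Qed.

Lemma generated_conj (R : comNzRingType) p (S : 'M[R]_p -> Prop) g h X :
    mx_inverse g h ->
    (forall Y, S Y -> generated S (g *m Y *m h)) ->
  generated S X -> generated S (g *m X *m h).
Proof.
move=> [gh hg] hS.
have conjM A B : (g *m A *m h) *m (g *m B *m h) = g *m (A *m B) *m h.
  by rewrite !mulmxA -[_ *m h *m g]mulmxA hg mulmx1.
elim=> [A /hS //||A B _ hA _ hB|A B _ hA [AB BA]].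
- by rewrite mulmx1 gh; apply: gen_one.
- by rewrite -conjM; apply: gen_mul.
by apply: gen_inv hA _; split; rewrite conjM ?AB ?BA mulmx1 gh.
Qed.

Lemma generated_map (A B : comNzRingType) (f : {rmorphism A -> B}) p
    (S : 'M[A]_p -> Prop) (S' : 'M[B]_p -> Prop) X :
    (forall Y, S Y -> generated S' (map_mx f Y)) ->
  generated S X -> generated S' (map_mx f X).
Proof.
move=> hS; elim=> [Y /hS //||Y Z _ hY _ hZ|Y Z _ hY [YZ ZY]].
- by rewrite map_mx1; apply: gen_one.
- by rewrite map_mxM; apply: gen_mul.
by apply: gen_inv hY _; split; rewrite -map_mxM ?YZ ?ZY map_mx1.
Qed.

Lemma ESp_Sp (R : comNzRingType) m (X : 'M[R]_(m.*2)) : ESp X -> Sp X.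
Proof. by apply: generated_Sp => Y [i [j [z [ij ->]]]]; apply: Sp_se. Qed.

(* [ERel 'X] is [ESpT]; the ideal [(T)] is replaced by a principal ideal [(y)] of an
   arbitrary ring so that the group can be specialized. *)
Definition ERel (R : comNzRingType) m (y : R) : 'M[R]_(m.*2) -> Prop :=
  generated (fun X => exists (g h : 'M[R]_(m.*2)) (i j : 'I_(m.*2)) (q : R),
    [/\ ESp g, mx_inverse g h, i != j & X = g *m se i j (y * q) *m h]).

Definition TRel (R : comNzRingType) m (y : R) : 'M[R]_(m.*2) -> Prop :=
  generated (fun X => exists (v : 'cV[R]_(m.*2)) (q : R), X = transv v (y * q)).

Lemma ERel_ESp (R : comNzRingType) m (y : R) (X : 'M[R]_(m.*2)) :
  ERel y X -> ESp X.
Proof.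
apply: generated_sub => Y [g [h [i [j [q [hg gh ij ->]]]]]].
apply: gen_mul; last exact: gen_inv hg gh.
by apply: gen_mul => //; apply: gen_in; exists i, j, (y * q).
Qed.

Lemma ERel_conj (R : comNzRingType) m (y : R) (g X : 'M[R]_(m.*2)) :
  ESp g -> ERel y X -> ERel y (g *m X *m adj g).
Proof.
move=> hg; have gK := Sp_mx_inverse (ESp_Sp hg); apply: (generated_conj gK).
move=> Y [k [h [i [j [q [hk [kh hk'] ij ->]]]]]]; apply: gen_in.
exists (g *m k), (h *m adj g), i, j, q; split=> //; first exact: gen_mul.
  case: gK => g1 g2; split; first by rewrite mulmxA -[_ *m k *m h]mulmxA kh mulmx1.
  by rewrite mulmxA -[_ *m adj g *m g]mulmxA g2 mulmx1.
by rewrite !mulmxA.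
Qed.

Lemma ERel_transv_bas (R : comNzRingType) m (y q : R) (i : 'I_(m.*2)) :
  ERel y (transv (bas R i) (y * q)).
Proof.
apply: gen_in; exists 1%:M, 1%:M, i, (sigma0 i), ((-1) ^+ i * q).
split; [exact: gen_one | by split; rewrite mulmx1 | by rewrite eq_sym sigma0_neq |].
by rewrite mul1mx mulmx1 se_long mulrCA signrMK.
Qed.

Lemma ERel_transv2_bas (R : comNzRingType) m (y q : R) (i k : 'I_(m.*2)) :
  i != k -> k != sigma0 i -> ERel y (transv2 (bas R i) (bas R k) (y * q)).
Proof.
move=> ik ki; apply: gen_in; exists 1%:M, 1%:M, i, (sigma0 k), ((-1) ^+ k * q).
split; [exact: gen_one | by split; rewrite mulmx1 | |].
  by rewrite -(inj_eq (can_inj (@sigma0K m))) sigma0K eq_sym.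
by rewrite mul1mx mulmx1 se_short sigma0K // mulrCA signrMK.
Qed.

(** Orthogonality is bundled in because [transv2_add] needs it whenever [q] is split into a sum. *)
Definition elem2 (R : comNzRingType) m (y : R) (p q : 'cV[R]_(m.*2)) : Prop :=
  sform p q = 0 /\ forall a, ERel y (transv2 p q (y * a)).

Lemma elem2Z (R : comNzRingType) m (y c : R) (p q : 'cV[R]_(m.*2)) :
  elem2 y p q -> elem2 y p (c *: q).
Proof.
move=> [pq h]; split=> [|a]; first by rewrite sformZr pq mulr0.
by rewrite transv2Z mulrCA; apply: h.
Qed.

Lemma elem2C (R : comNzRingType) m (y : R) (p q : 'cV[R]_(m.*2)) :
  elem2 y p q -> elem2 y q p.
Proof.
by move=> [pq h]; split=> [|a]; [rewrite sformC pq oppr0 | rewrite transv2C].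
Qed.

Lemma elem2_0 (R : comNzRingType) m (y : R) (p : 'cV[R]_(m.*2)) : elem2 y p 0.
Proof.
rewrite -[0](scale0r p); split=> [|a]; first by rewrite sformZr mul0r.
rewrite transv2Z mul0r /transv2 scale0r addr0; exact: gen_one.
Qed.

(** [v] is added up one coordinate at a time; the first hypothesis pays for the correction factors
    along [p] coming from [transv2_add]. *)
Lemma elem2_sum (R : comNzRingType) m (y : R) (p v : 'cV[R]_(m.*2)) :
    (forall a, ERel y (transv p (y * a))) ->
    (forall k, v k 0 = 0 \/ elem2 y p (bas R k)) ->
  elem2 y p v.
Proof.
move=> hp hv; rewrite (cV_sum_bas v); apply: (big_ind (elem2 y p)).
- exact: elem2_0.
- move=> q q' [pq hq] [pq' hq']; split=> [|a]; first by rewrite sformDr pq pq' addr0.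
  rewrite transv2_add //; apply: gen_mul.
    by apply: gen_mul; [apply: hq | apply: hq'].

  by rewrite expr2 -!mulrA -mulrN; apply: hp.
- move=> k _; case: (hv k) => [->|]; last exact: elem2Z.
  by rewrite scale0r; apply: elem2_0.
Qed.

(** The only basis vector not orthogonal to [bas R i] is its partner, which [v] misses. The others
    give root elements, short ones except for [bas R i] itself. *)
Lemma elem2_bas (R : comNzRingType) m (y : R) (i : 'I_(m.*2)) (v : 'cV[R]_(m.*2)) :
  v (sigma0 i) 0 = 0 -> elem2 y (bas R i) v.
Proof.
move=> vi; apply: elem2_sum => [a|k]; first exact: ERel_transv_bas.
have [->|ki] := eqVneq k (sigma0 i); [by left|right].
split=> [|a]; first by rewrite sform_bas (negPf ki).
have [->|ik] := eqVneq k i; first by rewrite transv2_self mulrCA; apply: ERel_transv_bas.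
by apply: ERel_transv2_bas; rewrite // eq_sym.
Qed.

(* With [e = bas i] and [f = bas (sigma0 i)], the elementary [transv2 f (c *: v) 1]
   carries [e] to [e + v], so that [transv (e + v) z] is conjugate to [transv e z]. *)
Lemma ERel_transv_missing (R : comNzRingType) m (y : R) (i : 'I_(m.*2))
    (v : 'cV[R]_(m.*2)) : v i 0 = 0 -> v (sigma0 i) 0 = 0 ->
  forall a, ERel y (transv v (y * a)).
Proof.
move=> vi vs a; set e := bas R i; set f := bas R (sigma0 i).
(* This sign is [sform f e], so that [c * sform f e] is 1 and [e] goes to exactly [e + v]. *)
pose c : R := (-1) ^+ (sigma0 i).
have [ev hev] : elem2 y e v by apply: elem2_bas.
have [fv hfv] : elem2 1 f (c *: v) by apply: elem2_bas; rewrite mxE sigma0K vi mulr0.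
have gE : ESp (transv2 f (c *: v) 1) by rewrite -(mulr1 1); apply: ERel_ESp (hfv 1).
have ge : transv2 f (c *: v) 1 *m e = e + v.
  rewrite transv2_mul sformZl sformC ev oppr0 !mulr0 scale0r addr0 sform_bas sigma0K.
  by rewrite eqxx mulr1n mul1r scalerA -exprD -signr_odd oddD addbb scale1r.
have hE : ERel y (transv (e + v) (y * a)).
  rewrite -ge -transv_conj; last exact: ESp_Sp.
  by apply: ERel_conj => //; apply: ERel_transv_bas.
have -> : transv v (y * a) =
    transv e (y * - a) *m (transv (e + v) (y * a) *m transv2 e v (y * - a)).
  apply: mulmx_cV_inj => w; have ve : sform v e = 0 by rewrite sformC ev oppr0.
  rewrite -!mulmxA !transv_mul transv2_mul !(sformDl, sformDr, sformZr) !sformvv ev ve.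
  by apply/matrixP => k l; rewrite !mxE; ring.
by apply: gen_mul; [apply: ERel_transv_bas | apply: gen_mul; [apply: hE | apply: hev]].
Qed.

(* [v] is the sum of its first block [p] and of the orthogonal rest [q]. *)
Lemma ERel_transv (R : comNzRingType) m (y : R) (v : 'cV[R]_(m.*2)) : (1 < m)%N ->
  forall a, ERel y (transv v (y * a)).
Proof.
move=> m1 a; have m2 : (2 < m.*2)%N by rewrite -[2%N]/1.*2 ltn_double.
(* Index 2 opens the second block, present because [m] is at least 2. The vector [p] misses that
   block and [q] misses the first one. *)
pose i0 : 'I_(m.*2) := Ordinal (ltn_trans (isT : 0 < 2)%N m2).
pose i2 : 'I_(m.*2) := Ordinal m2.
pose p : 'cV[R]_(m.*2) := \col_k (if (k < 2)%N then v k 0 else 0).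
pose q : 'cV[R]_(m.*2) := \col_k (if (k < 2)%N then 0 else v k 0).
have hv : v = p + q.
  by apply/colP => k; rewrite !mxE; case: ifP; rewrite ?addr0 ?add0r.
have hp : forall b, ERel y (transv p (y * b)).
  by apply: (@ERel_transv_missing _ _ _ i2); rewrite mxE.
have hq : forall b, ERel y (transv q (y * b)).
  by apply: (@ERel_transv_missing _ _ _ i0); rewrite mxE.
(* [q] involves only basis vectors outside the first block; [sigma0] preserves blocks, so [p]
   vanishes at their partners. *)
have [pq hpq] : elem2 y p q.
  apply: elem2_sum => // k; case k2: (k < 2)%N; [by left; rewrite mxE k2|right].
  apply/elem2C/elem2_bas; rewrite mxE.
  by rewrite ltnNge -half_gt0 sigma0_half half_gt0 -ltnNge k2.
have qp : sform q p = 0 by rewrite sformC pq oppr0.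
have -> : transv v (y * a) =
    transv p (y * a) *m (transv q (y * a) *m transv2 p q (y * a)).
  apply: mulmx_cV_inj => w; rewrite hv.
  rewrite -!mulmxA !transv_mul transv2_mul !(sformDl, sformDr, sformZr) !sformvv pq qp.
  by apply/matrixP => k l; rewrite !mxE; ring.
by apply: gen_mul; [apply: hp | apply: gen_mul; [apply: hq | apply: hpq]].
Qed.

(** * Splitting and dilation *)

Lemma TRel_Sp (R : comNzRingType) m (y : R) (X : 'M[R]_(m.*2)) : TRel y X -> Sp X.
Proof. by apply: generated_Sp => Y [v [q ->]]; apply: Sp_transv. Qed.

Lemma TRel_conj (R : comNzRingType) m (y : R) (g X : 'M[R]_(m.*2)) :
  Sp g -> TRel y X -> TRel y (g *m X *m adj g).
Proof.
move=> hg; apply: (generated_conj (Sp_mx_inverse hg)) => _ [v [q ->]].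
by apply: gen_in; exists (g *m v), q; rewrite transv_conj.
Qed.

Lemma TRel_adj (R : comNzRingType) m (y : R) (X : 'M[R]_(m.*2)) :
  TRel y X -> TRel y (adj X).
Proof. by move=> hX; apply: gen_inv hX (Sp_mx_inverse (TRel_Sp hX)). Qed.

Lemma TRel_transv (R : comNzRingType) m (y : R) (v : 'cV[R]_(m.*2)) q :
  TRel y (transv v (y * q)).
Proof. by apply: gen_in; exists v, q. Qed.

Lemma TRel_ERel (R : comNzRingType) m (y : R) (X : 'M[R]_(m.*2)) :
  (1 < m)%N -> TRel y X -> ERel y X.
Proof. by move=> m1; apply: generated_sub => _ [v [q ->]]; apply: ERel_transv. Qed.

Lemma TRel_mull (R : comNzRingType) m (r y : R) (X : 'M[R]_(m.*2)) :
  TRel (r * y) X -> TRel y X.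
Proof.
apply: generated_sub => _ [v [q ->]]; rewrite [r * y]mulrC -mulrA.
exact: TRel_transv.
Qed.

Lemma map_TRel (A B : comNzRingType) (f : {rmorphism A -> B}) m (y : A)
    (X : 'M[A]_(m.*2)) : TRel y X -> TRel (f y) (map_mx f X).
Proof.
apply: generated_map => _ [v [q ->]]; rewrite map_transv rmorphM.
exact: TRel_transv.
Qed.

Lemma TRel0 (R : comNzRingType) m (X : 'M[R]_(m.*2)) : TRel 0 X -> X = 1%:M.
Proof.
elim=> [_ [v [q ->]]||A B _ -> _ ->|A B _ -> [<- _]] //; last by rewrite mul1mx.
  by rewrite mul0r transv0.
by rewrite mulmx1.
Qed.

(** Evaluation at 0 as an endomorphism of R[T], so that P and P(0) can be multiplied. *)
Definition const0 (R : comNzRingType) : {poly R} -> {poly R} :=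
  polyC \o horner_eval (0 : R).

HB.instance Definition _ (R : comNzRingType) :=
  GRing.RMorphism.copy (@const0 R) (polyC \o horner_eval (0 : R)).

Lemma const0X (R : comNzRingType) : @const0 R 'X = 0.
Proof. by rewrite /const0 /= /horner_eval hornerX. Qed.

Lemma const0_sub (R : comNzRingType) (p : {poly R}) : exists q, p - @const0 R p = 'X * q.
Proof.
have : root (p - @const0 R p) 0.
  by rewrite /root /= hornerD hornerN hornerC /horner_eval subrr.
by case/factor_theorem => q ->; exists q; rewrite polyC0 subr0 mulrC.
Qed.

(** P factors as a product of transvections relative to (T) times P(0). Normality of [TRel] in [Sp]
    makes this property stable under products and inverses. *)
Definition split0 (R : comNzRingType) m (P : 'M[{poly R}]_(m.*2)) : Prop :=
  Sp P /\ TRel 'X (P *m adj (map_mx (@const0 R) P)).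

Lemma split0M (R : comNzRingType) m (P Q : 'M[{poly R}]_(m.*2)) :
  split0 P -> split0 Q -> split0 (P *m Q).
Proof.
move=> [sP hP] [sQ hQ]; split; first exact: SpM.
rewrite map_mxM adjM.
have -> : P *m Q *m (adj (map_mx (@const0 R) Q) *m adj (map_mx (@const0 R) P)) =
    (P *m (Q *m adj (map_mx (@const0 R) Q)) *m adj P) *m
    (P *m adj (map_mx (@const0 R) P)).
  by rewrite !mulmxA -[_ *m adj P *m P]mulmxA SpVl // mulmx1.
by apply: gen_mul => //; apply: TRel_conj.
Qed.

Lemma split0_adj (R : comNzRingType) m (P : 'M[{poly R}]_(m.*2)) :
  split0 P -> split0 (adj P).
Proof.
move=> [sP hP]; split; first exact: Sp_adj.
rewrite map_adj adjK.
have := TRel_conj (Sp_adj sP) (TRel_adj hP).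
by rewrite adjM !adjK -!mulmxA SpVl // mulmx1.
Qed.

(** With a constant vector, dividing by the value at 0 subtracts the constant term of [z], and T
    divides the rest. *)
Lemma split0_transv (R : comNzRingType) m (v : 'cV[{poly R}]_(m.*2)) z :
  map_mx (@const0 R) v = v -> split0 (transv v z).
Proof.
move=> hv; split; first exact: Sp_transv.
rewrite map_transv hv adj_transv transvD; have [q ->] := const0_sub z.
exact: TRel_transv.
Qed.

Lemma split0_ESp (R : comNzRingType) m (P : 'M[{poly R}]_(m.*2)) : ESp P -> split0 P.
Proof.
have hb k : map_mx (@const0 R) (bas {poly R} k) = bas {poly R} k :> 'cV_(m.*2).
  exact: map_delta_mx.
elim=> [_ [i [j [z [ij ->]]]]||A B _ hA _ hB|A B hA sA hAB].
- have [->|ij'] := eqVneq i (sigma0 j).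
    by rewrite -[X in se _ X](sigma0K j) se_long; apply: split0_transv.
  rewrite se_short // transv2E ?sform_bas_short //.
  by do ![apply: split0M | apply: split0_transv]; rewrite ?map_mxD !hb.
- by rewrite -(transv0 0); apply: split0_transv; rewrite map_mx0.
- exact: split0M.
by rewrite (Sp_inv_adj (proj1 sA) hAB); apply: split0_adj.
Qed.

(** The vector of a transvection may depend on T, so [split0_transv] does not apply directly; the
    detour through root elements makes all vectors constant. *)
Lemma TRel_split0 (R : comNzRingType) m (P : 'M[{poly R}]_(m.*2)) :
  (1 < m)%N -> TRel 1 P -> split0 P.
Proof. by move=> m1 /(TRel_ERel m1)/ERel_ESp; apply: split0_ESp. Qed.

(* [f] exhibits [B] as the localization [A[1/s]]. *)
Definition is_loc (A B : comNzRingType) (f : {rmorphism A -> B}) (s : A) : Prop :=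
  [/\ exists u, f s * u = 1,
      forall b, exists k a, f s ^+ k * b = f a
    & forall a, f a = 0 -> exists k, s ^+ k * a = 0].

Lemma is_loc_poly (A B : comNzRingType) (f : {rmorphism A -> B}) s :
  is_loc f s -> is_loc (map_poly f) s%:P.
Proof.
move=> [[u su] surj ker]; split.
- by exists u%:P; rewrite /= map_polyC -polyCM su.
- move=> p; rewrite /= map_polyC /=; elim/poly_ind: p => [|p c [k [a ka]]].
    by exists 0, 0; rewrite mulr0 rmorph0.
  have [l [b lb]] := surj c; exists (k + l)%N, ((s ^+ l)%:P * a * 'X + (s ^+ k * b)%:P).
  rewrite !(rmorphD, rmorphM, rmorphXn) /= !map_polyC map_polyX /= -ka -lb.
  by rewrite !(rmorphM, rmorphXn) /= exprD; ring.
move=> p; elim/poly_ind: p => [|p c IHp]; first by exists 0; rewrite mulr0.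
rewrite /= rmorphD rmorphM /= map_polyC map_polyX -(cons_poly_def (map_poly f p)).
move=> /polyP E.
have /IHp[k kp] : map_poly f p = 0.
  by apply/polyP => i; have := E i.+1; rewrite coef_cons !coef0.
have /ker[l lc] : f c = 0 by have := E 0; rewrite coef_cons coef0.
exists (k + l)%N.
rewrite mulrDr exprD mulrA [_ ^+ k * _ * p]mulrAC kp mul0r mul0r add0r -mulrA.
by rewrite -[_ ^+ l]rmorphXn -polyCM lc mulr0.
Qed.

(** Two successive localizations are a single one: [a] is a numerator of [r], and inverting [s * a]
    inverts both [s] and [r]. *)
Lemma is_loc_comp (A B C : comNzRingType) (f : {rmorphism A -> B})
    (g : {rmorphism B -> C}) s a r k :
  is_loc f s -> is_loc g r -> f a = f s ^+ k * r -> is_loc (g \o f) (s * a).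
Proof.
move=> [[u su] surjf kerf] [[w rw] surjg kerg] fa.
have fsa : f (s * a) = f s ^+ k.+1 * r by rewrite rmorphM fa exprS mulrA.
split.
- exists (g u ^+ k.+1 * w); rewrite /= fsa rmorphM rmorphXn mulrACA rw mulr1.
  by rewrite -exprMn -rmorphM su rmorph1 expr1n.
- move=> c; have [l [b lb]] := surjg c; have [j [x jx]] := surjf b.
  exists (l + j)%N, (a ^+ j * x * s ^+ (k.+1 * l)).
  rewrite /= fsa !rmorphM !rmorphXn fa -jx exprD !rmorphM !rmorphXn -lb.
  by rewrite !exprMn -!exprM !mulSn !exprD; ring.
move=> x /= /kerg[l lx].
have /kerf[j jx] : f (a ^+ l * x) = 0.
  by rewrite rmorphM rmorphXn fa exprMn -mulrA lx mulr0.
exists (j + l)%N; rewrite exprMn !exprD.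
have -> : s ^+ j * s ^+ l * (a ^+ j * a ^+ l) * x =
          s ^+ l * a ^+ j * (s ^+ j * (a ^+ l * x)) by ring.
by rewrite jx mulr0.
Qed.

Lemma is_loc_mx (A B : comNzRingType) (f : {rmorphism A -> B}) s p q
    (M : 'M[B]_(p, q)) : is_loc f s ->
  exists k (N : 'M[A]_(p, q)), f s ^+ k *: M = map_mx f N.
Proof.
move=> [_ surj _].
have /fin_all_exists[F hF] (ij : 'I_p * 'I_q) :
    exists ka : nat * A, f s ^+ ka.1 * M ij.1 ij.2 = f ka.2.
  by have [k [a ka]] := surj (M ij.1 ij.2); exists (k, a).
pose K := \max_ij (F ij).1.
exists K, (\matrix_(i, j) (s ^+ (K - (F (i, j)).1) * (F (i, j)).2)).
apply/matrixP => i j; rewrite !mxE rmorphM rmorphXn -hF mulrA -exprD subnK //.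
exact: (leq_bigmax (F := fun ij => (F ij).1)).
Qed.

Lemma is_loc_ker_mx (A B : comNzRingType) (f : {rmorphism A -> B}) s p q
    (M : 'M[A]_(p, q)) : is_loc f s -> map_mx f M = 0 ->
  exists k, s ^+ k *: M = 0.
Proof.
move=> [_ _ ker] /matrixP fM.
have /fin_all_exists[F hF] (ij : 'I_p * 'I_q) :
    exists k, s ^+ k * M ij.1 ij.2 = 0.
  by apply: ker; have := fM ij.1 ij.2; rewrite !mxE.
exists (\max_ij (F ij)); apply/matrixP => i j; rewrite !mxE.
rewrite -(subnK (leq_bigmax (F := F) (i, j))) exprD -mulrA.
by rewrite (hF (i, j)) mulr0.
Qed.

(** * Dilations of the variable *)

Definition dil (R : comNzRingType) (t : R) : {poly R} -> {poly R} :=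
  comp_poly (t *: 'X).

HB.instance Definition _ (R : comNzRingType) (t : R) :=
  GRing.RMorphism.copy (dil t) (comp_poly (t *: 'X)).

Lemma map_dil (A B : comNzRingType) (f : {rmorphism A -> B}) t p :
  map_poly f (dil t p) = dil (f t) (map_poly f p).
Proof. by rewrite /dil /= map_comp_poly linearZ /= map_polyX. Qed.

Lemma dil_dil (R : comNzRingType) (t u : R) p : dil t (dil u p) = dil (u * t) p.
Proof. by rewrite /dil /= -comp_polyA comp_polyZ comp_polyX scalerA. Qed.

Lemma dilX (R : comNzRingType) (t : R) : dil t 'X = t%:P * 'X.
Proof. by rewrite /dil /= comp_polyX mul_polyC. Qed.

Lemma dilC (R : comNzRingType) (t c : R) : dil t c%:P = c%:P.
Proof. by rewrite /dil /= comp_polyC. Qed.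

Lemma const0_dil (R : comNzRingType) (t : R) p : @const0 R (dil t p) = @const0 R p.
Proof.
by rewrite /const0 /dil /= /horner_eval horner_comp hornerZ hornerX mulr0.
Qed.

Lemma map_const0 (A B : comNzRingType) (f : {rmorphism A -> B}) p :
  map_poly f (@const0 A p) = @const0 B (map_poly f p).
Proof.
by rewrite /const0 /dil /= map_polyC /= /horner_eval -[in RHS](rmorph0 f) horner_map.
Qed.

(** The dilated variable supplies powers of [s] that clear the denominators of each generator. The
    free surplus [M] lets the two factors of a product be dilated by the same exponent. *)
Lemma dil_lift (A B : comNzRingType) (f : {rmorphism A -> B}) s m
    (P : 'M[{poly B}]_(m.*2)) : is_loc f s -> TRel 'X P ->
  exists N, forall M, exists2 Q : 'M[{poly A}]_(m.*2),
    TRel 'X Q & map_mx (map_poly f) Q = map_mx (dil (f s ^+ (N + M))) P.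
Proof.
move=> hs; elim=> [_ [v [q ->]]||P1 P2 _ [N1 h1] _ [N2 h2]|P1 P2 sP1 [N h] hP].
- have hsP := is_loc_poly hs; have [k [v' hv]] := is_loc_mx v hsP.
  have [_ surj _] := hsP; have [l [q' hq]] := surj q.
  rewrite /= map_polyC -rmorphXn /= in hv hq.
  (* The vector's denominator counts twice since [transvZ] is quadratic, and [l] clears the
     coefficient; the surplus s^M stays in the lifted coefficient. *)
  exists (k + k + l)%N => M; pose t := s ^+ (k + k + l + M).
  exists (transv (map_mx (dil t) v') ('X * ((s ^+ M)%:P * dil t q'))).
    exact: TRel_transv.
  have mapd p : map_poly f (dil t p) = dil (f s ^+ (k + k + l + M)) (map_poly f p).
    by rewrite map_dil rmorphXn.
  rewrite !map_transv.
  have -> : map_mx (map_poly f) (map_mx (dil t) v') =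
      (f s ^+ k)%:P *: map_mx (dil (f s ^+ (k + k + l + M))) v.
    have /(congr1 (map_mx (dil (f s ^+ (k + k + l + M))))) := hv.
    rewrite map_mxZ /= dilC => ->.
    by apply/matrixP => i j; rewrite !mxE mapd.
  rewrite transvZ !rmorphM /= mapd map_polyX map_polyC /= -hq.
  rewrite !(rmorphM, rmorphXn) /= dilC dilX !rmorphXn /=.
  by congr transv; rewrite !exprD; ring.
- by exists 0 => M; exists 1%:M; [exact: gen_one | rewrite !map_mx1].
- exists (N1 + N2)%N => M; have [Q1 q1 e1] := h1 (N2 + M)%N.
  have [Q2 q2 e2] := h2 (N1 + M)%N; exists (Q1 *m Q2); first exact: gen_mul.
  by rewrite !map_mxM e1 e2 !addnA [(N2 + N1)%N]addnC.
exists N => M; have [Q q e] := h M; exists (adj Q); first exact: TRel_adj.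
by rewrite map_adj e (Sp_inv_adj (TRel_Sp sP1) hP) map_adj.
Qed.

(** Write p = T q. Then t q = 0 because T is not a zero divisor, and after the substitution the
    factor tT supplies the t that kills q(tT). *)
Lemma dil_kill (R : comNzRingType) (t : R) (p : {poly R}) :
  @const0 R p = 0 -> t%:P * p = 0 -> dil t p = 0.
Proof.
move=> p0; have [q] := const0_sub p; rewrite p0 subr0 => ->; rewrite mulrCA => tXq.
have tq : t%:P * q = 0.
  by apply/polyP => i; have := coefXM (t%:P * q) i.+1; rewrite tXq !coef0.
rewrite rmorphM /= dilX -mulrA mulrCA.
have /(congr1 (dil t)) := tq; rewrite rmorphM /= dilC rmorph0 => ->.
by rewrite mulr0.
Qed.

(** Let H = G G(0)^-1. A dilate of H and its lift [Q] agree over [B], so their difference is killed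
    by a power of [s]; as it vanishes at T = 0, one more dilation makes it zero. *)
Lemma dilation (A B : comNzRingType) (f : {rmorphism A -> B}) s m
    (G : 'M[{poly A}]_(m.*2)) : (1 < m)%N -> is_loc f s -> Sp G ->
    TRel 1 (map_mx (map_poly f) G) ->
  exists N, TRel 'X (map_mx (dil (s ^+ N)) (G *m adj (map_mx (@const0 A) G))).
Proof.
move=> m1 hs sG /(TRel_split0 m1)[_ hG].
have c0H : map_mx (@const0 A) (G *m adj (map_mx (@const0 A) G)) = 1%:M.
  rewrite map_mxM map_adj /= -[in X in adj X]map_mx_comp.
  rewrite (eq_map_mx _ (_ : @const0 A \o @const0 A =1 @const0 A)).
    by rewrite SpVr //; apply: map_Sp.
  by move=> p; rewrite /= /const0 /= /horner_eval hornerC.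
set H := G *m _ in c0H *.
have {}hG : TRel 'X (map_mx (map_poly f) H).
  congr (TRel 'X _): hG; rewrite /H map_mxM map_adj; congr (_ *m adj _).
  by apply/matrixP => i j; rewrite !mxE /= map_const0.
have [N0 /(_ 0)[Q hQ eQ]] := dil_lift hs hG; rewrite addn0 in eQ.
pose D := map_mx (dil (s ^+ N0)) H - Q.
have Df : map_mx (map_poly f) D = 0.
  rewrite map_mxB eQ; apply/matrixP => i j; rewrite !mxE /= map_dil rmorphXn.
  by rewrite subrr.
have Q1 : map_mx (@const0 A) Q = 1%:M.
  by apply: TRel0; rewrite -(const0X A); apply: map_TRel.
have D0 : map_mx (@const0 A) D = 0.
  rewrite map_mxB Q1 -c0H; apply/matrixP => i j; rewrite !mxE /= const0_dil.
  by rewrite subrr.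
have [k kD] := is_loc_ker_mx (is_loc_poly hs) Df.
exists (N0 + k)%N.
have E : map_mx (dil (s ^+ k)) D = 0.
  apply/matrixP => i j; rewrite !mxE; apply: dil_kill.
    by have /matrixP/(_ i j) := D0; rewrite !mxE.
  by have /matrixP/(_ i j) := kD; rewrite !mxE rmorphXn.
have -> : map_mx (dil (s ^+ (N0 + k))) H = map_mx (dil (s ^+ k)) Q.
  apply/eqP; rewrite -subr_eq0 -[X in _ == X]E map_mxB; apply/eqP; congr (_ - _).
  by apply/matrixP => i j; rewrite !mxE /= dil_dil exprD.
by apply: (@TRel_mull _ _ (s ^+ k)%:P); rewrite -dilX; apply: map_TRel.
Qed.

(** * Localization at an element *)

(** The ideal generated by sT - 1, whose quotient inverts [s]. Carrying [hs] attaches properness,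
    hence a nonzero quotient, to the ideal instance. *)
Definition loc_ideal (R : comNzRingType) (s : R) (hs : forall k, s ^+ k != 0) :
  {pred {poly R}} := fun p => `[< exists q, p = q * (s *: 'X - 1) >].

(** Comparing coefficients forces the i-th coefficient of [q] to be - s^i a, and [q] has only
    finitely many. This gives both properness of the ideal and the kernel of the localization. *)
Lemma loc_const (R : comNzRingType) (s a : R) q :
  a%:P = q * (s *: 'X - 1) -> s ^+ size q * a = 0.
Proof.
move=> E; have coefE i : q`_i = - (s ^+ i * a).
  elim: i => [|i IHi].
    have := congr1 (fun p : {poly R} => p`_0) E.
    rewrite /= coefC mulrBr mulr1 coefB -mul_polyC mulrCA coefCM coefMX /= mulr0.
    by rewrite sub0r expr0 mul1r => ->; rewrite opprK.
  have := congr1 (fun p : {poly R} => p`_i.+1) E.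
  rewrite /= coefC mulrBr mulr1 coefB -mul_polyC mulrCA coefCM coefMX /= IHi.
  by move=> /esym/subr0_eq <-; rewrite mulrN mulrA -exprS.
by apply: oppr_inj; rewrite -coefE nth_default ?oppr0.
Qed.

Lemma loc_ideal_closed (R : comNzRingType) (s : R) (hs : forall k, s ^+ k != 0) :
  idealr_closed (loc_ideal hs).
Proof.
split.
- by apply/asboolP; exists 0; rewrite mul0r.
- apply/asboolP => -[q]; rewrite -[1]/(1%:P) => /loc_const/eqP.
  by rewrite mulr1 (negPf (hs _)).
move=> a p q /asboolP[p' ->] /asboolP[q' ->]; apply/asboolP; exists (a * p' + q').
by rewrite mulrDl mulrA.
Qed.

HB.instance Definition _ (R : comNzRingType) (s : R) (hs : forall k, s ^+ k != 0) :=
  isIdealr.Build {poly R} (loc_ideal hs) (loc_ideal_closed hs).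

Lemma loc_exists (R : comNzRingType) (s : R) : (forall k, s ^+ k != 0) ->
  exists (B : comNzRingType) (f : {rmorphism R -> B}), is_loc f s.
Proof.
move=> hs; pose B : comNzRingType := {ideal_quot (loc_ideal hs)}.
pose pr : {rmorphism {poly R} -> B} := \pi_B.
have pr0 p : pr p = 0 -> exists q, p = q * (s *: 'X - 1).
  rewrite -(rmorph0 pr) => /eqP; rewrite -[_ == _]/(p == 0 %[mod B]).
  by rewrite -Quotient.idealrBE subr0 => /asboolP.
have prX : pr s%:P * pr 'X = 1.
  rewrite -rmorphM mul_polyC -(rmorph1 pr).
  apply/eqP; rewrite -[_ == _]/(s *: 'X == 1 %[mod B]).
  by rewrite -Quotient.idealrBE; apply/asboolP; exists 1; rewrite mul1r.
exists B, (pr \o polyC); split; first by exists (pr 'X).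
- move=> b; rewrite -[b]reprK; elim/poly_ind: (repr b) => [|p c [k [a ka]]].
    by exists 0, 0; rewrite /= -[\pi_B _]/(pr _) !rmorph0 mulr0.
  exists k.+1, (a + s ^+ k.+1 * c); move: ka; rewrite /= -![\pi_B _]/(pr _) => ka.
  rewrite !rmorphD !rmorphM /= -ka !rmorphXn /= exprS.
  rewrite mulrDr; congr (_ + _); set u := pr s%:P in prX *.
  have -> : u * u ^+ k * (pr p * pr 'X) = (u * pr 'X) * (u ^+ k * pr p) by ring.
  by rewrite prX mul1r.
move=> a /pr0[q /loc_const]; by exists (size q).
Qed.

(** * Moving columns to standard position *)

(** The transvection along [a - b] with scalar [u] does it: vectors pairing equally with [a] and [b]
    are orthogonal to [a - b], hence fixed. *)
Lemma transv_move (R : comNzRingType) m (F : 'cV[R]_(m.*2) -> Prop)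
    (a b : 'cV[R]_(m.*2)) u :
    sform b a * u = 1 -> (forall x, F x -> sform a x = sform b x) ->
  exists E, [/\ TRel 1 E, E *m a = b & forall x, F x -> E *m x = x].
Proof.
move=> bau hF; exists (transv (a - b) (1 * u)); split; first exact: TRel_transv.
  rewrite transv_mul mul1r sformDl sformvv sformNl add0r mulrN mulrC bau.
  by rewrite scaleN1r opprB addrC subrK.
move=> x /hF abx; rewrite transv_mul sformDl sformNl abx subrr mulr0 scale0r.
exact: addr0.
Qed.

Lemma bas_move (R : comNzRingType) m (F : 'cV[R]_(m.*2) -> Prop) (i l : 'I_(m.*2)) :
    (forall x k, F x -> k \in [:: i; l; sigma0 i; sigma0 l] -> sform (bas R k) x = 0) ->
  exists E, [/\ TRel 1 E, E *m bas R l = bas R i & forall x, F x -> E *m x = x].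
Proof.
move=> hF.
have [->|il] := eqVneq i l.
  by exists 1%:M; split=> [||x _]; rewrite ?mul1mx //; apply: gen_one.
have [->|sil] := eqVneq l (sigma0 i).
  apply: (@transv_move _ _ _ _ _ ((-1) ^+ i)).
    by rewrite sform_bas eqxx mulr1n -expr2 sqrr_sign.
  by move=> x Fx; rewrite !hF // !inE eqxx ?orbT.
(* Here [bas R l] and [bas R i] are orthogonal, so the move passes through a vector whose pairing
   with each of them is a sign. *)
pose c := bas R (sigma0 l) + bas R (sigma0 i).
have hc x : F x -> sform c x = 0.
  by move=> Fx; rewrite sformDl !hF ?addr0 // !inE eqxx ?orbT.
have [E1 [TE1 E1l E1F]] : exists E,
    [/\ TRel 1 E, E *m bas R l = c & forall x, F x -> E *m x = x].
  apply: (@transv_move _ _ _ _ _ ((-1) ^+ (sigma0 l))).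
    rewrite sformDl !sform_bas !sigma0K eqxx [l == i]eq_sym (negPf il) addr0.
    by rewrite -expr2 sqrr_sign.
  by move=> x Fx; rewrite hc // hF // !inE eqxx ?orbT.
have [E2 [TE2 E2c E2F]] : exists E,
    [/\ TRel 1 E, E *m c = bas R i & forall x, F x -> E *m x = x].
  apply: (@transv_move _ _ _ _ _ ((-1) ^+ i)).
    rewrite sformDr !sform_bas eqxx (inj_eq (can_inj (@sigma0K m))) eq_sym (negPf il).
    by rewrite add0r -expr2 sqrr_sign.
  by move=> x Fx; rewrite hc // hF // !inE eqxx ?orbT.
exists (E2 *m E1); split; first exact: gen_mul.
  by rewrite -mulmxA E1l.
by move=> x Fx; rewrite -mulmxA E1F // E2F.
Qed.

Definition std_mx (R : comNzRingType) m n : 'M[R]_(m.*2, n.*2) :=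
  \matrix_(i, j) (i == j :> nat)%:R.

Definition isometric (R : comNzRingType) m n (U : 'M[R]_(m.*2, n.*2)) : Prop :=
  adj U *m U = 1%:M.

Lemma sform_col (R : comNzRingType) m n (U : 'M[R]_(m.*2, n.*2)) i j :
  isometric U -> sform (col i U) (col j U) = (-1) ^+ i *+ (j == sigma0 i).
Proof.
move=> hU; rewrite -psiE.
have -> : psi R n = U^T *m psi R m *m U.
  have /(congr1 (mulmx (psi R n))) := hU.
  rewrite /adj mulNmx mulmxN !mulmxA psi_sqr mulmx1 => <-.
  by rewrite !mulNmx mul1mx opprK.
rewrite /sform !colE trmx_mul trmx_delta !mulmxA -colE mxE.
by rewrite -!mulmxA -rowE [LHS]mxE.
Qed.

Lemma col_std_mx (R : comNzRingType) m n (h : (n.*2 <= m.*2)%N) j :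
  col j (std_mx R m n) = bas R (widen_ord h j).
Proof. by apply/colP => i; rewrite !mxE andbT. Qed.

Definition reduced (R : comNzRingType) m n k (U : 'M[R]_(m.*2, n.*2)) : Prop :=
  forall j : 'I_(n.*2), (j < k.*2)%N -> col j U = col j (std_mx R m n).

Lemma isometricM (R : comNzRingType) m n (E : 'M[R]_(m.*2)) (U : 'M[R]_(m.*2, n.*2)) :
  Sp E -> isometric U -> isometric (E *m U).
Proof.
by move=> hE hU; rewrite /isometric adjM mulmxA -[_ *m adj E *m E]mulmxA SpVl // mulmx1.
Qed.

Lemma map_isometric (A B : comNzRingType) (f : {rmorphism A -> B}) m n
    (U : 'M[A]_(m.*2, n.*2)) : isometric U -> isometric (map_mx f U).
Proof. by move=> hU; rewrite /isometric -map_adj -map_mxM hU map_mx1. Qed.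

Lemma leq_double_sigma0 m k (i : 'I_(m.*2)) : (k.*2 <= sigma0 i)%N = (k.*2 <= i)%N.
Proof. by rewrite -!geq_half_double sigma0_half. Qed.

(** The unit entry allows moving column [c] to a basis vector and then to its place. Its partner
    column is first shifted along the placed vector and then moved. Vectors already placed are
    orthogonal to all that is used, so they stay fixed. *)
Lemma reduced_step (R : comNzRingType) m n k (U : 'M[R]_(m.*2, n.*2))
    (c : 'I_(n.*2)) (j0 : 'I_(m.*2)) u :
    (n <= m)%N -> isometric U -> reduced k U -> (c : nat) = k.*2 -> U j0 c * u = 1 ->
  exists2 E, TRel 1 E & reduced k.+1 (E *m U).
Proof.
move=> nm hU rU ck U1; have h : (n.*2 <= m.*2)%N by rewrite leq_double.
pose w := widen_ord h; pose F x := exists2 j : 'I_(n.*2), (j < k.*2)%N & x = bas R (w j).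
have sc : (sigma0 c : nat) = k.*2.+1 by rewrite /= /sigma0_nat ck odd_double.
have sw j : sigma0 (w j) = w (sigma0 j) by apply: val_inj.
have colU (j : 'I_(n.*2)) : (j < k.*2)%N -> col j U = bas R (w j).
  by move=> jk; rewrite rU // col_std_mx.
have basF x (i : 'I_(m.*2)) : (k.*2 <= i)%N -> F x -> sform (bas R i) x = 0.
  move=> ki [j jk ->]; rewrite sform_bas; case: eqP => // /(congr1 val) /= E.
  by move: ki; rewrite -leq_double_sigma0 leqNgt /= -E jk.
have colF x (V : 'M[R]_(m.*2, n.*2)) (i : 'I_(n.*2)) : isometric V ->
    (forall j : 'I_(n.*2), (j < k.*2)%N -> col j V = bas R (w j)) ->
    (k.*2 <= i)%N -> F x -> sform (col i V) x = 0.
  move=> hV hcol ki [j jk ->]; rewrite -hcol // sform_col //.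
  case: eqP => // E; move: ki; rewrite -leq_double_sigma0 leqNgt -E jk //.
(* In the first 2k rows, an entry of column [c] is up to sign its pairing with a placed column,
   hence zero and not a unit. *)
have kj0 : (k.*2 <= j0)%N.
  rewrite leqNgt; apply/negP => j0k.
  have j0n : (sigma0 j0 < n.*2)%N.
    rewrite (@leq_trans k.*2) // ?leq_double; last first.
      by rewrite -leq_double -ck ltnW.
    by rewrite ltnNge leq_double_sigma0 -ltnNge.
  have : F (bas R (sigma0 j0)).
    exists (Ordinal j0n); first by rewrite ltnNge leq_double_sigma0 -ltnNge.
    by congr bas; apply: val_inj.
  move/(colF _ U c hU colU); rewrite ck leqnn => /(_ isT).
  rewrite sformC sform_basl sigma0K mxE => /eqP; rewrite oppr_eq0 => /eqP E.
  have := congr1 ( *%R ((-1) ^+ (sigma0 j0))) E; rewrite signrMK mulr0 => E0.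
  by move: U1; rewrite E0 mul0r => /eqP; rewrite eq_sym oner_eq0.
have [E1 [T1 E1r E1F]] : exists E, [/\ TRel 1 E, E *m col c U = bas R (sigma0 j0)
                                     & forall x, F x -> E *m x = x].
  apply: (@transv_move _ _ _ _ _ ((-1) ^+ (sigma0 j0) * u)).
    by rewrite sform_basl sigma0K mxE mulrACA -expr2 sqrr_sign mul1r.
  by move=> x Fx; rewrite basF ?leq_double_sigma0 // (colF _ U) // ck.
have kwc : (k.*2 <= w c)%N by rewrite /= ck.
have [E2 [T2 E2r E2F]] : exists E, [/\ TRel 1 E, E *m bas R (sigma0 j0) = bas R (w c)
                                     & forall x, F x -> E *m x = x].
  apply: bas_move => x i Fx; rewrite !inE sigma0K => /or4P[] /eqP-> ; apply: basF => //;
  by rewrite ?leq_double_sigma0.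
pose U2 := E2 *m E1 *m U.
have sE : Sp (E2 *m E1) by apply: SpM; apply: TRel_Sp; eassumption.
have hU2 : isometric U2 by apply: isometricM.
have colU2 (j : 'I_(n.*2)) : (j < k.*2)%N -> col j U2 = bas R (w j).
  move=> jk; rewrite colE -!mulmxA -colE colU //.
  by rewrite E1F ?E2F //; exists j.
have colcU2 : col c U2 = bas R (w c) by rewrite colE -!mulmxA -colE E1r E2r.
set r := col (sigma0 c) U2.
have odc : odd (w c) = false by rewrite /= ck odd_double.
have cr : sform (bas R (w c)) r = 1.
  by rewrite -colcU2 sform_col // eqxx -signr_odd ck odd_double.
(* Chosen so that the target vector pairs to exactly 1 with [r + z *: bas R (w c)]. *)
pose z := sform (bas R (w (sigma0 c))) r - 1.
have bb : sform (bas R (w (sigma0 c))) (bas R (w c)) = -1.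
  have swc : nat_of_ord (w (sigma0 c)) = k.*2.+1 by [].
  by rewrite sform_bas sw sigma0K eqxx -signr_odd swc /= odd_double.
pose E3 := transv (bas R (w c)) (1 * z).
have E3r : E3 *m r = r + z *: bas R (w c) by rewrite transv_mul cr mulr1 mul1r.
pose F' x := F x \/ x = bas R (w c).
have E3F x : F' x -> E3 *m x = x.
  case=> [Fx|->]; rewrite transv_mul; first by rewrite basF // mulr0 scale0r addr0.
  by rewrite sformvv mulr0 scale0r addr0.
have [E4 [T4 E4r E4F]] : exists E, [/\ TRel 1 E, E *m (E3 *m r) = bas R (w (sigma0 c))
                                     & forall x, F' x -> E *m x = x].
  apply: (@transv_move _ _ _ _ _ 1).
    by rewrite mulr1 E3r sformDr sformZr bb /z mulrN1 opprB addrC subrK.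
  move=> x [Fx|->]; rewrite E3r sformDl sformZl.
    have ks : (k.*2 <= sigma0 c)%N by rewrite sc leqnSn.
    by rewrite !basF // (colF _ U2) // mulr0 addr0.
  by rewrite sformvv mulr0 addr0 sformC cr bb.
exists (E4 *m (E3 *m (E2 *m E1))).
  by do ![apply: gen_mul => //]; apply: TRel_transv.
move=> j; rewrite doubleS !ltnS leq_eqVlt ltnS leq_eqVlt (col_std_mx R h).
have -> : col j (E4 *m (E3 *m (E2 *m E1)) *m U) = E4 *m (E3 *m col j U2).
  by rewrite !colE /U2 !mulmxA.
case/or3P => [/eqP jE|/eqP jE|jk].
- have -> : j = sigma0 c by apply: ord_inj; rewrite sc jE.
  by rewrite -/r E4r.
- have -> : j = c by apply: ord_inj; rewrite ck jE.
  by rewrite colcU2 E3F ?E4F //; right.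
rewrite colU2 // E3F ?E4F //; left; by exists j.
Qed.

Lemma reduced_full (R : comNzRingType) m n (U : 'M[R]_(m.*2, n.*2)) :
  reduced n U -> U = std_mx R m n.
Proof.
move=> rU; apply/matrixP => i j; have := rU j (ltn_ord j).
by move/colP/(_ i); rewrite !mxE.
Qed.

Lemma map_reduced (A B : comNzRingType) (f : {rmorphism A -> B}) m n k
    (U : 'M[A]_(m.*2, n.*2)) : reduced k U -> reduced k (map_mx f U).
Proof.
move=> rU j /rU /colP E; apply/colP => i; have := congr1 f (E i).
by rewrite !mxE => ->; rewrite rmorph_nat.
Qed.

(** * Reduction to standard position after successive localizations *)

Definition in_rad (R : comNzRingType) (J : R -> Prop) (x : R) : Prop :=
  exists N, J (x ^+ N).

Lemma in_radD (R : comNzRingType) (J : R -> Prop) :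
    J 0 -> (forall x y, J x -> J y -> J (x + y)) -> (forall r x, J x -> J (r * x)) ->
  forall x y, in_rad J x -> in_rad J y -> in_rad J (x + y).
Proof.
move=> J0 JD JM x y [N xN] [M yM]; exists (N + M)%N; rewrite exprDn.
apply: big_ind => // i _; rewrite -mulr_natl; apply: (JM).
have [Mi|iM] := leqP M i.
  by rewrite -(subnK Mi) [X in _ * X]exprD mulrA; apply: (JM).
have Ni : (N <= N + M - i)%N by rewrite -addnBA ?leq_addr // ltnW.
by rewrite -(subnK Ni) exprD mulrAC; apply: (JM).
Qed.

Lemma is_loc_id (R : comNzRingType) : is_loc (@idfun R : {rmorphism R -> R}) 1.
Proof.
split=> [|b|a /= ->]; first by exists 1; rewrite mulr1.
  by exists 0, b; rewrite mul1r.
by exists 0; rewrite mulr0.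
Qed.

(* After localizing at any one of its coordinates, the next column can be moved to
   its standard position, and these coordinates are comaximal. *)
Lemma loc_reduce (R : comNzRingType) m n (W : 'M[R]_(m.*2, n.*2)) (J : R -> Prop) :
    (n <= m)%N -> isometric W ->
    J 0 -> (forall x y, J x -> J y -> J (x + y)) -> (forall r x, J x -> J (r * x)) ->
    (forall (B : comNzRingType) (f : {rmorphism R -> B}) s E, is_loc f s ->
       TRel 1 E -> E *m map_mx f W = std_mx B m n -> in_rad J s) ->
  J 1.
Proof.
move=> nm hW J0 JD JM hJ.
have in_radM r x : in_rad J x -> in_rad J (r * x).
  by case=> N xN; exists N; rewrite exprMn; apply: (JM).
(* Induction on the number [d] of column pairs still to place; [s] is the element of [R] inverted so
   far, initially 1. *)
suff H d k : (k + d = n)%N -> forall (B : comNzRingType) (f : {rmorphism R -> B}) s E,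
    is_loc f s -> TRel 1 E -> reduced k (E *m map_mx f W) -> in_rad J s.
  have [|N] := H n 0 (add0n n) R idfun 1 1%:M (is_loc_id R) (gen_one _); first by [].
  by rewrite expr1n.
elim: d k => [|d IHd] k kn B f s E hs TE rE.
  apply: (hJ B f s E hs TE); apply: reduced_full.
  by rewrite addn0 in kn; rewrite kn in rE.
have cn : (k.*2 < n.*2)%N by rewrite ltn_double -kn -addSnnS leq_addr.
pose c : 'I_(n.*2) := Ordinal cn; set U := E *m map_mx f W in rE.
have hU : isometric U by apply/isometricM/map_isometric => //; apply: TRel_Sp TE.
have [K [X hX]] := is_loc_mx U hs; have [L [Y hY]] := is_loc_mx (adj U) hs.
have [_ _ ker] := hs.
have XE j : f (X j c) = f s ^+ K * U j c.
  by have /matrixP/(_ j c) := hX; rewrite !mxE => ->.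
have in_radX j : in_rad J (s * X j c).
  (* Localizing at a nilpotent entry would give the zero ring; in that case [s * X j c] is itself
     nilpotent, so a power of it is 0. *)
  have [[l rl]|nil] := pselect (exists l, (U j c) ^+ l = 0).
    have /ker[i si] : f (X j c ^+ l) = 0 by rewrite rmorphXn XE exprMn rl mulr0.
    exists (i + l)%N.
    have -> : (s * X j c) ^+ (i + l) = s ^+ l * X j c ^+ i * (s ^+ i * X j c ^+ l).
      by rewrite exprMn !exprD; ring.
    by rewrite si mulr0.
  have [C [g hg]] : exists (C : comNzRingType) (g : {rmorphism B -> C}), is_loc g (U j c).
    by apply: loc_exists => l; apply/eqP => Ul; apply: nil; exists l.
  have [[u Uu] _ _] := hg.
  have TgE : TRel 1 (map_mx g E) by rewrite -(rmorph1 g); apply: map_TRel.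
  have [|||| E' TE' rE'] := @reduced_step C m n k (map_mx g U) c j u nm.
  - exact: map_isometric.
  - exact: map_reduced.
  - by [].
  - by rewrite mxE.
  apply: (IHd k.+1 _ C (g \o f) _ (E' *m map_mx g E)).
  - by rewrite addSnnS.
  - exact: is_loc_comp hs hg (XE j).
  - exact: gen_mul.
  have -> : map_mx (g \o f) W = map_mx g (map_mx f W).
    by apply/matrixP => a b; rewrite !mxE.
  by rewrite -mulmxA -map_mxM.
(* The diagonal entry of [adj U *m U] shows that the entries of column [c] are comaximal in [B];
   below, the relation is cleared of denominators. *)
have sum1 : \sum_j adj U c j * U j c = 1.
  by have /matrixP/(_ c c) := hU; rewrite [LHS]mxE [RHS]mxE eqxx.
have YE j : f (Y c j) = f s ^+ L * adj U c j.
  by have /matrixP/(_ c j) := hY; rewrite [LHS]mxE [RHS]mxE => ->.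
have [l El] : exists l, s ^+ l * (\sum_j Y c j * X j c - s ^+ (K + L)) = 0.
  apply: ker; rewrite rmorphB rmorph_sum rmorphXn -[f s ^+ (K + L)]mulr1 -sum1.
  rewrite mulr_sumr -sumrB big1 // => j _; rewrite rmorphM XE YE exprD.
  by apply/eqP; rewrite subr_eq0; apply/eqP; ring.
(* In [R], a power of [s] is a combination of the elements [s * X j c], all in the radical. *)
have [N] : in_rad J (s ^+ (l + (K + L)).+1).
  have -> : s ^+ (l + (K + L)).+1 = \sum_j (s ^+ l * Y c j) * (s * X j c).
    move: El; rewrite mulrBr => /subr0_eq E0; rewrite exprS exprD -E0.
    by rewrite !mulr_sumr; apply: eq_bigr => j _; ring.
  apply: big_ind => [||j _]; last exact: in_radM.
    by exists 1; rewrite expr1.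
  exact: in_radD.
by rewrite -exprM => ?; eexists; eassumption.
Qed.

(** * The obstruction and its Quillen ideal *)

(** One formula for both sides: [sigma] is the case U = [adj V], and [stab] the case U = [std_mx];
    [extend_mull] compares them by conjugation. *)
Definition extend (R : comNzRingType) m n (U : 'M[R]_(m.*2, n.*2)) (D : 'M[R]_(n.*2)) :
  'M[R]_(m.*2) := 1%:M + U *m (D - 1%:M) *m adj U.

Lemma extend1 (R : comNzRingType) m n (U : 'M[R]_(m.*2, n.*2)) : extend U 1%:M = 1%:M.
Proof. by rewrite /extend subrr mulmx0 mul0mx addr0. Qed.

Lemma extendM (R : comNzRingType) m n (U : 'M[R]_(m.*2, n.*2)) (D D' : 'M[R]_(n.*2)) :
  isometric U -> extend U D *m extend U D' = extend U (D *m D').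
Proof.
move=> hU; rewrite /extend mulmxDl mul1mx mulmxDr mulmx1 -!addrA; congr (_ + _).
have -> : U *m (D - 1%:M) *m adj U *m (U *m (D' - 1%:M) *m adj U) =
          U *m ((D - 1%:M) *m (D' - 1%:M)) *m adj U.
  by rewrite !mulmxA -[_ *m adj U *m U]mulmxA hU mulmx1.
rewrite -!mulmxDl -!mulmxDr; congr (_ *m _ *m _).
by rewrite mulmxBl mul1mx mulmxBr mulmx1; apply/matrixP => i j; rewrite !mxE; ring.
Qed.

Lemma adj_extend (R : comNzRingType) m n (U : 'M[R]_(m.*2, n.*2)) (D : 'M[R]_(n.*2)) :
  adj (extend U D) = extend U (adj D).
Proof.
have adjD p q (X Y : 'M[R]_(p.*2, q.*2)) : adj (X + Y) = adj X + adj Y.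
  by rewrite /adj linearD /= mulmxDr mulmxDl opprD.
have adjN p q (X : 'M[R]_(p.*2, q.*2)) : adj (- X) = - adj X.
  by rewrite /adj linearN /= mulmxN mulNmx.
by rewrite /extend adjD adj_mx1 !adjM adjK adjD adjN adj_mx1 mulmxA.
Qed.

Lemma Sp_extend (R : comNzRingType) m n (U : 'M[R]_(m.*2, n.*2)) (D : 'M[R]_(n.*2)) :
  isometric U -> Sp D -> Sp (extend U D).
Proof.
by move=> hU hD; apply/SpP; rewrite adj_extend extendM // SpVl // extend1.
Qed.

Lemma extend_mull (R : comNzRingType) m n (E : 'M[R]_(m.*2)) (U : 'M[R]_(m.*2, n.*2))
    (D : 'M[R]_(n.*2)) : Sp E -> extend (E *m U) D = E *m extend U D *m adj E.
Proof.
by move=> hE; rewrite /extend adjM mulmxDr mulmx1 mulmxDl SpVr // !mulmxA.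
Qed.

Lemma map_extend (A B : comNzRingType) (f : {rmorphism A -> B}) m n
    (U : 'M[A]_(m.*2, n.*2)) (D : 'M[A]_(n.*2)) :
  map_mx f (extend U D) = extend (map_mx f U) (map_mx f D).
Proof. by rewrite /extend map_mxD !map_mxM map_mxB !map_mx1 map_adj. Qed.

Lemma map_std_mx (A B : comNzRingType) (f : {rmorphism A -> B}) m n :
  map_mx f (std_mx A m n) = std_mx B m n.
Proof. by apply/matrixP => i j; rewrite !mxE rmorph_nat. Qed.

Lemma adj_std_mx (R : comNzRingType) m n : (n <= m)%N ->
  adj (std_mx R m n) = (std_mx R m n)^T.
Proof.
rewrite -leq_double => h.
suff E : psi R n *m (std_mx R m n)^T = (std_mx R m n)^T *m psi R m.
  by rewrite /adj E -mulmxA psi_sqr mulmxN mulmx1 opprK.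
apply/matrixP => j i; rewrite !mxE.
rewrite (bigD1 (sigma0 j)) //= big1 ?addr0 => [|k /negPf kj]; last first.
  by rewrite psiE kj mulr0n mul0r.
rewrite (bigD1 (widen_ord h j)) //= big1 ?addr0 => [|k kj]; last first.
  by rewrite !mxE (_ : (k == j :> nat) = false) ?mul0r //; apply/negP => /eqP E;
     case/eqP: kj; apply: val_inj.
by rewrite !psiE !mxE !eqxx mul1r mulr1n mulr_natr.
Qed.

Lemma isometric_std_mx (R : comNzRingType) m n : (n <= m)%N ->
  isometric (std_mx R m n).
Proof.
move=> nm; have h : (n.*2 <= m.*2)%N by rewrite leq_double.
rewrite /isometric adj_std_mx //; apply/matrixP => i j; rewrite !mxE.
rewrite (bigD1 (widen_ord h i)) //= big1 ?addr0 => [|k ki]; last first.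
  by rewrite !mxE (_ : (k == i :> nat) = false) ?mul0r //; apply/negP => /eqP E;
     case/eqP: ki; apply: val_inj.
by rewrite !mxE eqxx mul1r.
Qed.

(** The sizes are variables so that the equation p + (q - p) = q can be eliminated; a plain block
    computation remains. *)
Lemma conform_perp (R : comNzRingType) p q (C : 'M[R]_q) (D : 'M[R]_p)
    (S : 'M[R]_(q, p)) : (p <= q)%N -> S = \matrix_(i, j) (i == j :> nat)%:R ->
  conform_mx C (perp D (1%:M : 'M[R]_(q - p))) = 1%:M + S *m (D - 1%:M) *m S^T.
Proof.
move=> pq hS; move: (q - p)%N (subnKC pq) => r e.
case: q / e C S hS {pq} => C S hS; rewrite conform_mx_id.
have {hS}-> : S = col_mx 1%:M 0.
  apply/matrixP => i j; rewrite hS mxE; case: (splitP i) => k ik.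
    have -> : i = lshift r k by apply: val_inj.
    by rewrite col_mxEu mxE.
  have -> : i = rshift p k by apply: val_inj.
  rewrite col_mxEd mxE /= (_ : (p + k == j)%N = false) //.
  by apply/negP => /eqP E; have := ltn_ord j; rewrite -E -ltn_subRL subnn.
rewrite tr_col_mx trmx1 trmx0 mul_col_mx mul1mx mul0mx mul_col_row mulmx1 !mulmx0 !mul0mx.
by rewrite scalar_mx_block add_block_mx !addr0 addrC subrK.
Qed.

Lemma stab_extend (R : comNzRingType) m n (D : 'M[R]_(n.*2)) : (n <= m)%N ->
  stab m D = extend (std_mx R m n) D.
Proof.
move=> nm; rewrite /extend adj_std_mx // /stab.
by apply: conform_perp; rewrite ?leq_double.
Qed.

(** * Evaluation at points of algebras, and the Quillen ideal *)

Definition evp (R A : comNzRingType) (f : {rmorphism R -> A}) (x : A) :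
  {poly R} -> A := horner_eval x \o map_poly f.

HB.instance Definition _ (R A : comNzRingType) (f : {rmorphism R -> A}) (x : A) :=
  GRing.RMorphism.copy (evp f x) (horner_eval x \o map_poly f).

Lemma evpX (R A : comNzRingType) (f : {rmorphism R -> A}) (x : A) : evp f x 'X = x.
Proof. by rewrite /evp /= map_polyX /horner_eval hornerX. Qed.

Lemma evpC (R A : comNzRingType) (f : {rmorphism R -> A}) (x : A) c : evp f x c%:P = f c.
Proof. by rewrite /evp /= map_polyC /= /horner_eval hornerC. Qed.

(** The universal property of R[T]; it identifies composite substitutions by their values on
    constants and on T. *)
Lemma evp_unique (R A : comNzRingType) (f : {rmorphism R -> A}) (x : A)
    (g : {rmorphism {poly R} -> A}) :
  (forall c, g c%:P = f c) -> g 'X = x -> g =1 evp f x.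
Proof.
move=> gC gX; elim/poly_ind => [|p c IHp]; first by rewrite !rmorph0.
by rewrite !rmorphD !rmorphM /= IHp gX gC evpX evpC.
Qed.

(** With W = [adj V] this is sigma(T)^-1 (delta(T) perp I). *)
Definition obstruction (R : comNzRingType) m n (W : 'M[R]_(m.*2, n.*2))
    (D : 'M[{poly R}]_(n.*2)) : 'M[{poly R}]_(m.*2) :=
  adj (extend (const_poly_mx W) D) *m extend (std_mx {poly R} m n) D.

(** Quantifying over all algebras and points makes closure under sums and multiples a matter of
    substitution. *)
Definition quillen (R : comNzRingType) m (G : 'M[{poly R}]_(m.*2)) (s : R) : Prop :=
  forall (A : comNzRingType) (f : {rmorphism R -> A}) (x y : A),
    TRel y (map_mx (evp f (x + f s * y)) G *m adj (map_mx (evp f x) G)).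

Lemma quillen0 (R : comNzRingType) m (G : 'M[{poly R}]_(m.*2)) : Sp G -> quillen G 0.
Proof.
move=> sG A f x y; rewrite rmorph0 mul0r addr0 SpVr; first exact: gen_one.
exact: map_Sp.
Qed.

(** The quotient telescopes through the intermediate point x + ty. *)
Lemma quillenD (R : comNzRingType) m (G : 'M[{poly R}]_(m.*2)) s t :
  Sp G -> quillen G s -> quillen G t -> quillen G (s + t).
Proof.
move=> sG hs ht A f x y; rewrite rmorphD mulrDl [f s * y + _]addrC addrA.
have := gen_mul (hs A f (x + f t * y) y) (ht A f x y).
rewrite mulmxA -[_ *m adj _ *m map_mx _ _]mulmxA SpVl ?mulmx1 //.
exact: map_Sp.
Qed.

Lemma quillenM (R : comNzRingType) m (G : 'M[{poly R}]_(m.*2)) r s :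
  quillen G s -> quillen G (r * s).
Proof.
move=> hs A f x y; have := hs A f x (f r * y).
by rewrite rmorphM mulrCA mulrA => /TRel_mull.
Qed.

(** Specialize to the algebra R[T] with x = 0 and y = T. *)
Lemma quillen1 (R : comNzRingType) m (G : 'M[{poly R}]_(m.*2)) :
  eval_mx 0 G = 1%:M -> quillen G 1 -> TRel 'X G.
Proof.
move=> G0 /(_ {poly R} polyC 0 'X); congr (TRel _ _).
have -> : map_mx (evp polyC 0) G = 1%:M.
  rewrite -(map_mx1 polyC) -G0; apply/matrixP => i j; rewrite !mxE.
  apply/esym/(evp_unique (g := polyC \o horner_eval (0 : R))) => [c|] /=.
    by rewrite /horner_eval hornerC.
  by rewrite /horner_eval hornerX.
rewrite adj_mx1 mulmx1 rmorph1 mul1r add0r; apply/matrixP => i j; rewrite mxE.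
by apply/esym/(evp_unique (g := idfun)).
Qed.

(** [E] conjugates one extension into the other, so the obstruction is E^-1 (P^-1 E P) with P
    symplectic, and [TRel 1] is normal in [Sp]. *)
Lemma TRel_obstruction_std (R : comNzRingType) m n (W : 'M[R]_(m.*2, n.*2))
    (D : 'M[{poly R}]_(n.*2)) E :
    (n <= m)%N -> isometric W -> Sp D -> TRel 1 E -> E *m W = std_mx R m n ->
  TRel 1 (obstruction W D).
Proof.
move=> nm hW hD TE EW; set P := extend (std_mx {poly R} m n) D.
have sP : Sp P by apply: Sp_extend => //; apply: isometric_std_mx.
pose E' := map_mx polyC E.
have TE' : TRel 1 E' by rewrite -(rmorph1 polyC); apply: map_TRel.
have sE' := TRel_Sp TE'.
have -> : obstruction W D = adj E' *m (adj P *m E' *m adj (adj P)).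
  rewrite /obstruction.
  have -> : const_poly_mx W = adj E' *m std_mx {poly R} m n.
    by rewrite -(map_std_mx polyC) -EW map_mxM mulmxA SpVl ?mul1mx //.
  rewrite extend_mull; last exact: Sp_adj.
  by rewrite !adjM !adjK !mulmxA.
apply: gen_mul; first exact: TRel_adj.
by apply: TRel_conj => //; apply: Sp_adj.
Qed.

Lemma map_obstruction (A B : comNzRingType) (f : {rmorphism A -> B}) m n
    (W : 'M[A]_(m.*2, n.*2)) (D : 'M[{poly A}]_(n.*2)) :
  map_mx (map_poly f) (obstruction W D) =
  obstruction (map_mx f W) (map_mx (map_poly f) D).
Proof.
have E : map_mx (map_poly f) (const_poly_mx W) = const_poly_mx (map_mx f W).
  by apply/matrixP => i j; rewrite !mxE /= map_polyC.
by rewrite /obstruction map_mxM map_adj 2!map_extend map_std_mx E.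
Qed.

(** Apply [dilation] over R[X] to G(X + Y), with Y the dilated variable. This gives G(X + s^N Y)
    G(X)^-1 relative to (Y), and every pair of points is a specialization of (X, Y). *)
Lemma quillen_loc (R B : comNzRingType) (f : {rmorphism R -> B}) m
    (G : 'M[{poly R}]_(m.*2)) s :
    (1 < m)%N -> Sp G -> is_loc f s -> TRel 1 (map_mx (map_poly f) G) ->
  in_rad (quillen G) s.
Proof.
move=> m1 sG hs TG.
pose cc (A : comNzRingType) : {rmorphism A -> {poly {poly A}}} := polyC \o polyC.
pose XY (A : comNzRingType) : {poly {poly A}} := 'X%:P + 'X.
pose G2 := map_mx (evp (cc R) (XY R)) G.
have sG2 : Sp G2 by apply: map_Sp.
have TG2 : TRel 1 (map_mx (map_poly (map_poly f)) G2).
  have -> : map_mx (map_poly (map_poly f)) G2 =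
            map_mx (evp (cc B) (XY B)) (map_mx (map_poly f) G).
    apply/matrixP => i j; rewrite !mxE.
    pose g1 : {rmorphism {poly R} -> {poly {poly B}}} :=
      map_poly (map_poly f) \o evp (cc R) (XY R).
    pose g2 : {rmorphism {poly R} -> {poly {poly B}}} :=
      evp (cc B) (XY B) \o map_poly f.
    transitivity (evp (cc B \o f) (XY B) (G i j)).
      apply: (@evp_unique _ _ (cc B \o f) (XY B) g1) => [c|]; rewrite /g1 /=.
        by rewrite evpC /= !map_polyC /= map_polyC.
      by rewrite evpX rmorphD /= map_polyC map_polyX /= map_polyX.
    apply/esym/(@evp_unique _ _ (cc B \o f) (XY B) g2) => [c|]; rewrite /g2 /=.
      by rewrite map_polyC /= evpC.
    by rewrite map_polyX evpX.
  by rewrite -(rmorph1 (evp (cc B) (XY B))); apply: map_TRel.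
have [N hN] := dilation m1 (is_loc_poly hs) sG2 TG2.
exists N => A g x y.
(* The inner variable goes to [x], the outer one to [y]. *)
pose e : {rmorphism {poly {poly R}} -> A} := evp (evp g x) y.
have := map_TRel e hN; rewrite [e 'X]evpX !map_mxM !map_adj.
congr (TRel _ (_ *m adj _)); apply/matrixP => i j; rewrite !mxE.
  pose h : {rmorphism {poly R} -> A} := e \o dil (s%:P ^+ N) \o evp (cc R) (XY R).
  apply: (@evp_unique _ _ g _ h) => [c|]; rewrite /h /= ?evpC ?evpX.
    by rewrite dilC /e evpC /= evpC.
  rewrite /XY [dil _ _]rmorphD /= dilC dilX [evp _ _ _]rmorphD rmorphM /= !evpC.
  by rewrite !evpX /= evpX -[s%:P ^+ N]rmorphXn evpC.
pose h : {rmorphism {poly R} -> A} :=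
  e \o dil (s%:P ^+ N) \o @const0 _ \o evp (cc R) (XY R).
apply: (@evp_unique _ _ g _ h) => [c|]; rewrite /h /= ?evpC ?evpX.
  by rewrite /const0 /= /horner_eval hornerC dilC /e evpC /= evpC.
rewrite rmorphD /= const0X addr0 /const0 /= /horner_eval hornerC dilC /e.
by rewrite evpC /= evpX.
Qed.

Lemma TRel_obstruction (R : comNzRingType) m n (W : 'M[R]_(m.*2, n.*2))
    (D : 'M[{poly R}]_(n.*2)) :
    (1 < m)%N -> (n <= m)%N -> isometric W -> Sp D -> eval_mx 0 D = 1%:M ->
  TRel 'X (obstruction W D).
Proof.
move=> m1 nm hW hD D0.
have hW' : isometric (const_poly_mx W) by apply: map_isometric.
have hS := isometric_std_mx {poly R} nm.
have sG : Sp (obstruction W D).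
  by apply: SpM; [apply/Sp_adj/Sp_extend | apply: Sp_extend].
apply: quillen1.
  rewrite /eval_mx /obstruction map_mxM map_adj !map_extend -![map_mx _ D]/(eval_mx 0 D).
  by rewrite D0 !extend1 adj_mx1 mulmx1.
apply: (loc_reduce nm hW) => [|s t hs ht|r s hs|B f s E hs TE EW].
- exact: quillen0.
- exact: quillenD.
- exact: quillenM.
apply: (quillen_loc m1 sG hs); rewrite map_obstruction.
apply: TRel_obstruction_std EW => //; first exact: map_isometric.
exact: map_Sp.
Qed.

Lemma ERel_ESpT (R : comNzRingType) m (X : 'M[{poly R}]_(m.*2)) : ERel 'X X -> ESpT X.
Proof.
apply: generated_sub => _ [g [h [i [j [q [hg gh ij ->]]]]]]; apply: gen_in.
by exists g, h, i, j, ('X * q); split=> //; exists q; rewrite mulrC.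
Qed.

Theorem theorem3p13 (R : comNzRingType) (m n : nat)
    (hmn : ((n < m)%N /\ (2 <= n)%N) \/ (m = n /\ (3 <= n)%N))
    (V : 'M[R]_(n.*2, m.*2)) (hV : SpUm V)
    (delta : 'M[R]_(n.*2)) (hdelta : Sp delta)
    (hhom : symplectic_homotopic_id delta)
    (deltaT : 'M[{poly R}]_(n.*2)) (hdeltaT : homotopy delta deltaT) :
  exists sigmaT : 'M[{poly R}]_(m.*2),
    [/\ SpT sigmaT,
        deltaT *m const_poly_mx V = const_poly_mx V *m sigmaT,
        (exists2 sigmaT_inv, mx_inverse sigmaT sigmaT_inv
                           & ESpT (sigmaT_inv *m stab m deltaT))
      & let sigma := eval_mx 1 sigmaT in
        delta *m V = V *m sigma /\
        (exists2 sigma_inv, mx_inverse sigma sigma_inv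
                          & ESp (sigma_inv *m stab m delta))].
Proof.
have [m1 nm] : (1 < m)%N /\ (n <= m)%N.
  case: hmn => [[nm n2]|[-> n3]]; split=> //; last exact: ltnW.
    exact: ltn_trans nm.
  exact: ltnW.
have [sD D0 D1] := hdeltaT; have [_ hVpsi] := hV.
have hW : isometric (adj V).
  by rewrite /isometric adjK /adj mulmxN !mulmxA hVpsi psi_sqr opprK.
have hW' : isometric (const_poly_mx (adj V)) by apply: map_isometric.
have TG := TRel_obstruction m1 nm hW sD D0.
set S := extend (const_poly_mx (adj V)) deltaT.
have sS : Sp S by apply: Sp_extend.
(* Since V W = 1, multiplying 1 + W (delta - 1) V by V on the left leaves V + (delta - 1) V. *)
have DV : deltaT *m const_poly_mx V = const_poly_mx V *m S.
  have VW : const_poly_mx V *m const_poly_mx (adj V) = 1%:M.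
    by rewrite -map_mxM; move: hW; rewrite /isometric adjK => ->; rewrite map_mx1.
  have adjW : adj (const_poly_mx (adj V)) = const_poly_mx V by rewrite -map_adj adjK.
  rewrite /S /extend adjW mulmxDr mulmx1 !mulmxA VW mul1mx mulmxBl mul1mx.
  by rewrite addrC subrK.
have evalC (a : R) p q (M : 'M[R]_(p, q)) : eval_mx a (const_poly_mx M) = M.
  by apply/matrixP => i j; rewrite !mxE /horner_eval hornerC.
exists S; split=> //.
- split=> //; rewrite /S /eval_mx map_extend -[map_mx _ deltaT]/(eval_mx 0 deltaT).
  by rewrite D0 extend1.
- exists (adj S); first exact: Sp_mx_inverse.
  by apply: ERel_ESpT; apply: TRel_ERel; rewrite // stab_extend.
split.
  rewrite -[in LHS](evalC 1 _ _ V) -D1 -map_mxM DV map_mxM.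
  by rewrite -[map_mx _ (const_poly_mx V)]/(eval_mx 1 _) evalC.
exists (adj (eval_mx 1 S)); first exact/Sp_mx_inverse/map_Sp.
(* Evaluation at T = 1 sends the ideal (T) to the unit ideal, so relative transvections become
   ordinary ones. *)
have : TRel 1 (map_mx (horner_eval (1 : R)) (obstruction (adj V) deltaT)).
  by have := map_TRel (horner_eval (1 : R)) TG; congr (TRel _ _); apply: hornerX.
rewrite /obstruction map_mxM map_adj [X in _ *m X]map_extend.
rewrite map_std_mx -[map_mx _ deltaT]/(eval_mx 1 deltaT) D1 -stab_extend //.
by move=> /(TRel_ERel m1)/ERel_ESp.
Qed.
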